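(* Let $K$ be a kernel of order $l$, let $0<\beta_*<1$, $L^*>0$, $0<\varepsilon<1$, $M>0$, $\alpha\in(0,1)$, and let $\kappa_1\ge 1/(2\beta_* )$, $c_1>\frac{2}{\beta_*\log 2}$, $\kappa_2>c_1\log 2+4$. Let $\mathscr P_n=\mathscr P_n(K,\beta_*,L^*,\varepsilon,M)$, the confidence band $C_{n,\alpha}=(C_{n,\alpha}(t))_{t\in[0,1]}$ and the $n$-dependent local Hölder exponent $\beta_{n,p}(t)$ be as defined in the context, where the constant $c_2=c_2(A,\nu,\beta_*,L^*,K,\varepsilon)$ in the bandwidth selection rule is sufficiently large (that is, $c_2\ge\bar c_2$ for some threshold $\bar c_2=\bar c_2(A,\nu,\beta_*,L^*,K,\varepsilon)$ which exists). Then there exists some $\gamma=\gamma(c_1)$ such that $$\limsup_{n\to\infty}\ \sup_{p\in\mathscr P_n}\mathbb P_p^{\chi_2}\left(\sup_{t\in[0,1]}|C_{n,\alpha}(t)|\cdot\left(\frac{\log\tilde n}{\tilde n}\right)^{-\frac{\beta_{n,p}(t)}{2\beta_{n,p}(t)+1}}\ge(\log\tilde n)^\gamma\right)=0,$$ where $|C_{n,\alpha}(t)|$ is the length of the interval $C_{n,\alpha}(t)$ and the exponent is read as $-1/2$ when $\beta_{n,p}(t)=\infty$.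
   Context: **Sampling.** $X_1,\dots,X_n$ ($n\ge4$) are i.i.d. real random variables with law $\mathbb P_p$ having a continuous Lebesgue density $p$ on $\mathbb R$. $\tilde n=\lfloor n/2\rfloor$ (ordinary floor), $\chi_1=\{X_1,\dots,X_{\tilde n}\}$, $\chi_2=\{X_{\tilde n+1},\dots,X_{2\tilde n}\}$; $\mathbb P_p^{\chi_2}$ is the joint law of $X_{\tilde n+1},\dots,X_{2\tilde n}$. $\log$ is the natural logarithm. **Kernel.** $K:\mathbb R\to\mathbb R$ is measurable, symmetric, supported in $[-1,1]$, of bounded variation, with $\int K=1$. It is of order $l\in\mathbb N$: $\int x^jK(x)\,dx=0$ for $1\le j\le l$ and $\int x^{l+1}K(x)\,dx\ne0$. Put $\beta^*=l+1$, $K_h(\cdot)=h^{-1}K(\cdot/h)$. $A,\nu$ are finite positive constants with $N(\mathcal K,\|\cdot\|_{L^q(Q)},\epsilon\|K\|_{\sup})\le(A/\epsilon)^\nu$ for all $0<\epsilon\le1$, $q=1,2$ and all probability measures $Q$, where $\mathcal K=\{K((\cdot-t)/h):t\in\mathbb R,h>0\}$ and $N$ is the covering number by closed balls (such constants exist). $\hat p_n^{(1)}(t,h)=\tilde n^{-1}\sum_{i=1}^{\tilde n}K_h(X_i-t)$ and $\hat p_n^{(2)}(t,h)=\tilde n^{-1}\sum_{i=\tilde n+1}^{2\tilde n}K_h(X_i-t)$; for $j\in\mathbb N$, $\hat p_n^{(2)}(t,j):=\hat p_n^{(2)}(t,2^{-j})$. **Hölder classes.** $B(t,r)=(t-r,t+r)$;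 $\|f\|_U=\sup_U|f|$; for smoothness indices $\lfloor\beta\rfloor=\max\{m\in\mathbb N\cup\{0\}:m<\beta\}$. $\mathcal H_U(\beta,L)$ is the set of $p:U\to\mathbb R$ with derivatives up to order $\lfloor\beta\rfloor$ and $\sum_{k=0}^{\lfloor\beta\rfloor}\|p^{(k)}\|_U+\sup_{x\ne y\in U}\frac{|p^{(\lfloor\beta\rfloor)}(x)-p^{(\lfloor\beta\rfloor)}(y)|}{|x-y|^{\beta-\lfloor\beta\rfloor}}\le L$. $\mathcal P_U(\beta,L)$ is the set of probability densities $p$ on $\mathbb R$ with $p_{|U}\in\mathcal H_U(\beta,L)$. For a bounded open interval $U$ and $\beta>0$, $$\|p\|_{\beta,\beta^*,U}=\sum_{k=0}^{\lfloor\beta\wedge\beta^*\rfloor}\|p^{(k)}\|_U+\sup_{x\ne y\in U}\frac{|p^{(\lfloor\beta\wedge\beta^*\rfloor)}(x)-p^{(\lfloor\beta\wedge\beta^*\rfloor)}(y)|}{|x-y|^{\beta-\lfloor\beta\wedge\beta^*\rfloor}},$$ $\mathcal H_{\beta^*,U}(\beta,L)$ is the set of $p:U\to\mathbb R$ with derivatives up to order $\lfloor\beta\wedge\beta^*\rfloor$ and $\|p\|_{\beta,\beta^*,U}\le L$, and $\mathcal H_{\beta^*,U}(\infty,L)=\bigcap_{\beta>0}\mathcal H_{\beta^*,U}(\beta,L)$. Expressions $f(\infty)$ mean $\lim_{\beta\to\infty}f(\beta)$ (so $g^\infty=0$ for $0<g<1$). **Admissible densities.** $j_{\min}=\lceil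 2\vee\log_2(2/\varepsilon)\rceil$, $\mathcal G_\infty=\{2^{-j}:j\in\mathbb N,\ j\ge j_{\min}\}$. $\mathscr P_n^{\rm adm}(K,\beta_*,L^*,\varepsilon)$ is the set of $p\in\mathcal P_{(-\varepsilon,1+\varepsilon)}(\beta_*,L^* )$ such that for every $t\in[0,1]$ and $h\in\mathcal G_\infty$ there is $\beta\in[\beta_*,\beta^*]\cup\{\infty\}$ such that, for $u=h$ or $u=2h$, both $p_{|B(t,u)}\in\mathcal H_{\beta^*,B(t,u)}(\beta,L^* )$ and $\sup_{s\in B(t,u-g)}|(K_g*p)(s)-p(s)|\ge g^\beta/\log n$ for all $g\in\mathcal G_\infty$ with $g\le u/8$. $\mathscr P_n(K,\beta_*,L^*,\varepsilon,M)=\{p\in\mathscr P_n^{\rm adm}(K,\beta_*,L^*,\varepsilon):\inf_{x\in[-\varepsilon,1+\varepsilon]}p(x)\ge M\}$. Parameters are assumed to be such that $\mathscr P_n$ is non-empty. **Local exponent.** $h_{\beta,n}=2^{-j_{\min}}(\log\tilde n/\tilde n)^{1/(2\beta+1)}$ and $\beta_{n,p}(t)=\sup\{\beta>0:p_{|B(t,h_{\beta,n})}\in\mathcal H_{\beta^*,B(t,h_{\beta,n})}(\beta,L^* )\}\in[0,\infty]$, with $\sup\emptyset=0$. **Estimator.** $\delta_n=\left\lceil2^{j_{\min}/\beta_*}(\log\tilde n/\tilde n)^{-\kappa_1}(\log\tilde n)^{2/\beta_*}\right\rceil^{-1}$, $\mathcal H_n=\{k\delta_n:k\in\mathbb Z\}$,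 $T_n=\{1,\dots,\delta_n^{-1}\}$, $\mathcal J_n=\{j\in\mathbb N:j_{\min}\le j\le j_{\max}\}$, $j_{\max}=\lfloor\log_2(\tilde n/(\log\tilde n)^{\kappa_2})\rfloor$ ($n$ large enough that $\mathcal J_n\neq\emptyset$). For $t\in[0,1]$, $$\mathcal A_n(t)=\Big\{j\in\mathcal J_n:\max_{s\in B(t,\frac78 2^{-j})\cap\mathcal H_n}|\hat p_n^{(2)}(s,m)-\hat p_n^{(2)}(s,m')|\le c_2\sqrt{\tfrac{\log\tilde n}{\tilde n2^{-m}}}\ \text{ for all }m,m'\in\mathcal J_n\text{ with }m>m'>j+2\Big\},$$ $\hat j_n(t)=\min\mathcal A_n(t)$. With $u_n=c_1\log\log\tilde n$, for $k\in T_n$: $\hat h_{n,k}^{loc}=\min\{2^{-\hat j_n((k-1)\delta_n)-u_n},2^{-\hat j_n(k\delta_n)-u_n}\}$. With $I_k=[(k-1)\delta_n,k\delta_n)$ for $k<\delta_n^{-1}$ and $I_{\delta_n^{-1}}=[1-\delta_n,1]$, for $t\in I_k$ set $\hat h_n^{loc}(t)=\hat h_{n,k}^{loc}$ and $\hat p_n^{loc}(t,h)=\hat p_n^{(1)}(k\delta_n,h)$. **Confidence band.** With $TV(K)$ the total variation of $K$, $c_3=\sqrt2/TV(K)$, $a_n=c_3(-2\log\delta_n)^{1/2}$, $b_n=\frac{3}{c_3}\left\{(-2\log\delta_n)^{1/2}-\frac{\log(-\log\delta_n)+\log4\pi}{2(-2\log\delta_n)^{1/2}}\right\}$, $q_{1-\alpha/2}$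 the $(1-\alpha/2)$-quantile of the standard Gumbel distribution (distribution function $x\mapsto\exp(-e^{-x})$), and $q_n(\alpha)=\frac{\sqrt{L^*}\,q_{1-\alpha/2}}{a_n}+b_n$, $$C_{n,\alpha}(t)=\left[\hat p_n^{loc}(t,\hat h_n^{loc}(t))-\frac{q_n(\alpha)}{\sqrt{\tilde n\hat h_n^{loc}(t)}},\ \hat p_n^{loc}(t,\hat h_n^{loc}(t))+\frac{q_n(\alpha)}{\sqrt{\tilde n\hat h_n^{loc}(t)}}\right].$$ *)

(* Defs.v *)
From HB Require Import structures.
From mathcomp Require Import all_boot all_order all_algebra.
From mathcomp Require Import all_classical all_reals all_analysis.
From mathcomp Require Import measurable_realfun.

Set Implicit Arguments.
Unset Strict Implicit.
Unset Printing Implicit Defensive.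

Import Order.TTheory GRing.Theory Num.Theory.
Import numFieldNormedType.Exports.

Local Open Scope classical_set_scope.
Local Open Scope ring_scope.

Record density (R : realType) := Density {
  pdf :> R -> R;
  pdf_continuous : continuous pdf;
  pdf_ge0 : forall x, 0 <= pdf x;
  pdf_integral : (\int[lebesgue_measure]_x (pdf x)%:E = 1)%E }.

Section density_law.
Context {R : realType}.
Variable p : density R.

Definition law (A : set (measurableTypeR R)) : \bar R :=
  (\int[lebesgue_measure]_(x in A) (p x)%:E)%E.

Let measurable_pdf : measurable_fun [set: R] (fun x => (p x)%:E).
Proof.
apply/measurable_EFinP; apply: continuous_measurable_fun.
exact: pdf_continuous.
Qed.

Let law0 : law set0 = 0%E.
Proof. exact: integral_set0. Qed.

Let law_ge0 A : (0 <= law A)%E.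
Proof. by apply: integral_ge0 => x _; rewrite lee_fin pdf_ge0. Qed.

Let law_sigma_additive : semi_sigma_additive law.
Proof.
move=> F mF tF mUF; rewrite /law ge0_integral_bigcup//; last 2 first.
- exact: measurable_funTS.
- by move=> x _; rewrite lee_fin pdf_ge0.
apply: is_cvg_ereal_nneg_natsum_cond => k _ _.
by apply: integral_ge0 => x _; rewrite lee_fin pdf_ge0.
Qed.

HB.instance Definition _ := isMeasure.Build _ _ _ law
  law0 law_ge0 law_sigma_additive.

Let law_setT : law setT = 1%E.
Proof. exact: pdf_integral. Qed.

HB.instance Definition _ := Measure_isProbability.Build _ _ _ law law_setT.

End density_law.

Section iid_law.
Context {d : measure_display} {T : measurableType d} {R : realType}.
Variable P : probability T R.

Definition tuple_cons (m : nat) (xs : T * m.-tuple T) : m.+1.-tuple T :=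
  [tuple of xs.1 :: xs.2].

Let measurable_tuple_cons (m : nat) : measurable_fun setT (@tuple_cons m).
Proof. exact: measurable_cons. Qed.

HB.instance Definition _ (m : nat) :=
  isMeasurableFun.Build _ _ _ _ (@tuple_cons m) (@measurable_tuple_cons m).

(** [m]-fold product of [P], pushed forward along [(x, xs) |-> x :: xs]. *)
Fixpoint iid_law (m : nat) : probability (m.-tuple T) R :=
  match m with
  | 0 => \d_([tuple] : 0.-tuple T)
  | m'.+1 => distribution (P \x iid_law m')%E (@tuple_cons m')
  end.

End iid_law.


Section kernel.
Context {R : realType}.
Implicit Types (f g K : R -> R) (U : set R).

Definition sup_norm U f : \bar R := ereal_sup [set `|f x|%:E | x in U].

Definition line_variation f : \bar R :=
  ereal_sup [set total_variation ab.1 ab.2 f | ab in [set ab | ab.1 <= ab.2]].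

Record is_kernel K : Prop := IsKernel {
  kernel_measurable : measurable_fun [set: R] K;
  kernel_symmetric : forall x, K (- x) = K x;
  kernel_support : forall x, 1 < `|x| -> K x = 0;
  kernel_bounded_variation : (line_variation K < +oo)%E;
  kernel_integral : (\int[lebesgue_measure]_x (K x)%:E = 1)%E }.

Definition kernel_moment K (j : nat) : \bar R :=
  (\int[lebesgue_measure]_x (x ^+ j * K x)%:E)%E.

Definition kernel_order K (l : nat) : Prop :=
  [/\ (1 <= l)%N,
      forall j, (1 <= j <= l)%N -> kernel_moment K j = 0%E &
      kernel_moment K l.+1 <> 0%E].

(** The centres of the covering balls may be arbitrary elements of [L^q(Q)]. *)
Definition covering_number (Q : probability (measurableTypeR R) R) (q : nat)
    (F : set (R -> R)) (r : \bar R) : \bar R :=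
  ereal_inf [set m%:R%:E | m in [set m : nat |
    exists g : 'I_m -> R -> R,
      (forall i, measurable_fun [set: R] (g i) /\
                 ('N[Q]_(q%:R%:E) [EFin \o g i] < +oo)%E) /\
      (forall f, F f ->
         exists i, ('N[Q]_(q%:R%:E) [EFin \o (f \- g i)%R] <= r)%E)]].

Definition kernel_class K : set (R -> R) :=
  [set f | exists t h, 0 < h /\ f = fun x => K ((x - t) / h)].

Definition kernel_entropy K (A nu : R) : Prop :=
  forall (Q : probability (measurableTypeR R) R) (q : nat) (e : R),
    (q == 1)%N || (q == 2)%N -> 0 < e <= 1 ->
    (covering_number Q q (kernel_class K) (e%:E * sup_norm setT K)
       <= ((A / e) `^ nu)%:E)%E.

Definition scaled K (h : R) : R -> R := fun x => h^-1 * K (x / h).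

Definition convolution f g : R -> R :=
  fun s => \int[lebesgue_measure]_y (f (s - y) * g y).

End kernel.

Section hoelder_classes.
Context {R : realType}.
Implicit Types (p : R -> R) (U : set R) (b L t r : R).

(** Largest natural number strictly below [b], not the usual floor. *)
Definition strict_floor b : nat := `|Num.ceil b|.-1.

Lemma strict_floorP b : 0 < b ->
  (strict_floor b)%:R < b <= (strict_floor b).+1%:R.
Proof.
move=> b0; have c0 : 0 < Num.ceil b by rewrite ceil_gt0.
have a0 : (0 < `|Num.ceil b|)%N by rewrite absz_gt0 gt_eqF.
have ac : `|Num.ceil b|%:R = (Num.ceil b)%:~R :> R.
  by rewrite natr_absz gtr0_norm.
rewrite /strict_floor prednK// ac ceil_ge andbT -subn1 natrB// ac.
by have /andP[+ _] := ceil_itv b; rewrite intrB.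
Qed.

Definition derivatives_upto (m : nat) U p : Prop :=
  forall k x, (k < m)%N -> U x -> derivable (derive1n k p) x 1.

Definition hoelder_quotients (m : nat) b U p : set (\bar R) :=
  [set z | exists x y, [/\ U x, U y, x != y &
    z = (`|derive1n m p x - derive1n m p y| / `|x - y| `^ (b - m%:R))%:E]].

Definition hoelder_norm (m : nat) b U p : \bar R :=
  (\sum_(0 <= k < m.+1) sup_norm U (derive1n k p) +
   ereal_sup (hoelder_quotients m b U p))%E.

(** [H_U(b, L)]; only the values of [p] on the open set [U] matter. *)
Definition hoelder_class U b L p : Prop :=
  derivatives_upto (strict_floor b) U p /\
  (hoelder_norm (strict_floor b) b U p <= L%:E)%E.

(** [H_{bmax,U}(b, L)] for finite [b], then for [b] in [(0, +oo]]. *)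
Definition hoelder_capped bmax U b L p : Prop :=
  let m := strict_floor (Num.min b bmax) in
  derivatives_upto m U p /\ (hoelder_norm m b U p <= L%:E)%E.

Definition hoelder_capped_ext bmax U (b : \bar R) L p : Prop :=
  match b with
  | b'%:E => hoelder_capped bmax U b' L p
  | +oo%E => forall b', 0 < b' -> hoelder_capped bmax U b' L p
  | -oo%E => False
  end.

Definition oball t r : set R := `]t - r, t + r[%classic.

(** [g ^ b] for [0 < g < 1], with [g ^ +oo = 0]. *)
Definition pow_ext (g : R) (b : \bar R) : R :=
  if b is b'%:E then g `^ b' else 0.

(** [b / (2 b + 1)], with limit [1 / 2] at [+oo]. *)
Definition rate_exponent (b : \bar R) : R :=
  match b with
  | b'%:E => b' / (2 * b' + 1)
  | +oo%E => 2^-1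
  | -oo%E => 0
  end.

End hoelder_classes.

Section admissible.
Context {R : realType}.
Variables (K : R -> R) (l : nat) (bmin L eps : R).

Let bmax : R := l.+1%:R.

Definition log2 (x : R) : R := ln x / ln 2.

Definition jmin : nat := `|Num.ceil (Num.max 2 (log2 (2 / eps)))|.

Definition bandwidths : set R := [set 2 ^- j | j in [set j | (jmin <= j)%N]].

Definition self_similar (n : nat) (p : R -> R) (t : R) (b : \bar R) (u : R) :
    Prop :=
  hoelder_capped_ext bmax (oball t u) b L p /\
  forall g, bandwidths g -> g <= u / 8 ->
    ((pow_ext g b / ln n%:R)%R%:E <=
     sup_norm (oball t (u - g)%R) (convolution (scaled K g) p \- p)%R)%E.

Definition adm_densities (n : nat) : set (density R) :=
  [set p : density R |
    hoelder_class `]- eps, 1 + eps[ bmin L p /\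
    forall t h, 0 <= t <= 1 -> bandwidths h ->
      exists b : \bar R,
        ((bmin%:E <= b <= bmax%:E)%E \/ b = +oo%E) /\
        (self_similar n p t b h \/ self_similar n p t b (2 * h))].

Definition densities (M : R) (n : nat) : set (density R) :=
  [set p : density R | adm_densities n p /\
    (M%:E <= ereal_inf [set (p x)%:E | x in `[(- eps)%R, (1 + eps)%R]])%E].

Definition local_radius (n : nat) (b : R) : R :=
  2 ^- jmin * (ln (n./2)%:R / (n./2)%:R) `^ (2 * b + 1)^-1.

(** The added [0] implements the convention [sup set0 = 0]. *)
Definition local_exponent (n : nat) (p : R -> R) (t : R) : \bar R :=
  ereal_sup (0%E |` [set b%:E | b in [set b : R | 0 < b /\
    hoelder_capped bmax (oball t (local_radius n b)) b L p]]).

End admissible.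

Section band.
Context {R : realType}.
Variables (K : R -> R) (bmin L eps : R) (k1 k2 c1 c2 : R) (n : nat).

Let nt : nat := n./2.
Let N : R := nt%:R.

Definition kde (m : nat) (x : m.-tuple R) (t h : R) : R :=
  m%:R^-1 * \sum_(i < m) scaled K h (tnth x i - t).

Definition delta_inv : nat :=
  `|Num.ceil (2 `^ ((jmin eps)%:R / bmin) * (ln N / N) `^ (- k1) *
              ln N `^ (2 / bmin))|.

Definition delta : R := delta_inv%:R^-1.

Definition grid : set R := [set k%:~R * delta | k in [set: int]].

Definition jmax : int := Num.floor (log2 (N / ln N `^ k2)).

Definition exponents : set nat :=
  [set j : nat | (jmin eps <= j)%N /\ (j%:Z <= jmax)%R].

Definition admissible_exponents (x2 : nt.-tuple R) (t : R) : set nat :=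
  [set j : nat | exponents j /\
    forall m m', exponents m -> exponents m' -> (m' < m)%N -> (j + 2 < m')%N ->
    forall s, oball t (7 / 8 * 2 ^- j) s -> grid s ->
      `|kde x2 s (2 ^- m) - kde x2 s (2 ^- m')|
        <= c2 * Num.sqrt (ln N / (N * 2 ^- m))].

(** Junk value [0] when [A] is empty. *)
Definition least (A : set nat) : nat :=
  xget 0%N [set j | A j /\ forall k, A k -> (j <= k)%N].

Definition jhat (x2 : nt.-tuple R) (t : R) : nat :=
  least (admissible_exponents x2 t).

Definition undersmoothing : R := c1 * ln (ln N).

Definition cell_bandwidth (x2 : nt.-tuple R) (k : nat) : R :=
  Num.min (2 `^ (- (jhat x2 (k.-1%:R * delta))%:R - undersmoothing))
          (2 `^ (- (jhat x2 (k%:R * delta))%:R - undersmoothing)).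

Definition cell (k : nat) : set R :=
  if (k < delta_inv)%N then `[k.-1%:R * delta, k%:R * delta[%classic
  else `[1 - delta, 1]%classic.

Definition cell_index (t : R) : nat :=
  xget 0%N [set k | (1 <= k <= delta_inv)%N /\ cell k t].

Definition hloc (x2 : nt.-tuple R) (t : R) : R :=
  cell_bandwidth x2 (cell_index t).

Definition ploc (x1 : nt.-tuple R) (t h : R) : R :=
  kde x1 ((cell_index t)%:R * delta) h.

Definition c3 : R := Num.sqrt 2 / fine (line_variation K).

Definition a_seq : R := c3 * Num.sqrt (- 2 * ln delta).

Definition b_seq : R :=
  3 / c3 * (Num.sqrt (- 2 * ln delta) -
            (ln (- ln delta) + ln (4 * pi)) / (2 * Num.sqrt (- 2 * ln delta))).

Definition gumbel_cdf (x : R) : R := expR (- expR (- x)).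

Definition gumbel_quantile (u : R) : R := inf [set x | u <= gumbel_cdf x].

Definition critical_value (alpha : R) : R :=
  Num.sqrt L * gumbel_quantile (1 - alpha / 2) / a_seq + b_seq.

Definition confidence_band (alpha : R) (x1 x2 : nt.-tuple R) (t : R) : set R :=
  let h := hloc x2 t in
  let w := critical_value alpha / Num.sqrt (N * h) in
  `[ploc x1 t h - w, ploc x1 t h + w]%classic.

End band.

(** [x1] and [x2] are the values of the two subsamples; the length of the band
    depends on [x2] only. *)
Definition normalised_width {R : realType} (K : R -> R) (l : nat)
    (bmin L eps k1 k2 c1 c2 alpha : R) (n : nat) (p : R -> R)
    (x1 x2 : (n./2).-tuple R) : \bar R :=
  ereal_sup [set
    (lebesgue_measure
       (confidence_band K bmin L eps k1 k2 c1 c2 alpha x1 x2 t) *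
     ((ln (n./2)%:R / (n./2)%:R)
        `^ (- rate_exponent (local_exponent l L eps n p t)))%:E)%E
    | t in `[0, 1]].

(* Main.v *)
Require Import Defs.
From mathcomp Require Import all_boot all_order all_algebra.
From mathcomp Require Import all_classical all_reals all_analysis.
From mathcomp Require Import measurable_realfun.
From mathcomp Require Import ring lra zify.

Set Implicit Arguments.
Unset Strict Implicit.
Unset Printing Implicit Defensive.

Import Order.TTheory GRing.Theory Num.Theory.
Import numFieldNormedType.Exports.

Local Open Scope classical_set_scope.
Local Open Scope ring_scope.

(** Write [N] for the size of a subsample and [r = ln N / N]. Let [b] be an
exponent such that [p] is in the capped Hoelder class of order [b] on the ball
of radius [h_b = 2^-jmin * r^(1/(2b+1))] around [t]. The half-width of the band
at [t] is the critical value, which is of order [sqrt (ln N)], divided by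
[sqrt (N h)], where [h] is the selected bandwidth. The theorem therefore follows
once [h >= h_b / 4 * (ln N)^(- c1 ln 2)] holds for all such [t] and [b] at once,
outside an event of probability O(N^-2) that is uniform in [p]: the width times
[r^(-b/(2b+1))] is then O((ln N)^(c1 ln 2 / 2)), one power of [ln N] below the
threshold, and such a bound passes to the supremum of the exponents [b]
([power_rate_sup]).

The lower bound on the bandwidth ([bandwidth_lower_bound]) is the usual property
of Lepski's rule. Take [j] with [2^-j] between [h_b / 4] and [h_b / 2]. All the
bandwidths that the test at [j] compares are at most [2^-j / 8], so by Taylor's
formula and the moment conditions their biases are O(2^(-jb))
([hoelder_capped_taylor], [kernel_bias]). As [2^-j <= r^(1/(2b+1))], this is
below the noise level [sqrt (ln N / (N g))] of each of these bandwidths [g]. If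
the stochastic errors are of that order too, then [j] passes the test when [c2]
exceeds a sum of constants, and the selected exponent, being the least one to
pass, is at most [j]. The mesh is finer than [h_b] when [b >= bmin]; smaller [b]
do not affect the supremum, because [bmin] always qualifies.

The constant in the stochastic error must not depend on how fine the mesh is, so
the error is controlled uniformly in the location rather than point by point on
the mesh. A kernel of bounded variation is on [-1, 1] a difference of two
nondecreasing functions, whose superlevel sets are intervals. Hence the error at
location [s] and bandwidth [g] is at most a constant times [1 / g] times the
largest discrepancy between frequency and probability among the intervals inside
[s - g, s + g] ([kernel_interval_discrepancy]). Each interval lies between two
intervals with end points in [Z / N] and almost the same probability, and there
are polynomially many of those, so that Chernoff's inequality and a union bound
conclude ([chernoff_count], [interval_deviation]). *)

(** * Taylor expansion in Hoelder classes *)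

Lemma antiderivative_poly (R : realType) (q : {poly R}) (c : R) :
  exists Q : {poly R}, [/\ (size Q <= (size q).+1)%N, Q`_0 = c & Q^`() = q].
Proof.
exists (\poly_(i < (size q).+1) (if i is j.+1 then q`_j / j.+1%:R else c)).
split; [exact: size_poly|by rewrite coef_poly|].
apply/polyP => i; rewrite coef_deriv coef_poly ltnS.
case: ltnP => [_|qi]; last by rewrite mul0rn nth_default.
by rewrite /= -[LHS]mulr_natr divfK// pnatr_eq0.
Qed.

Lemma oball_itv_sub (R : realType) (c r x y z : R) :
  oball c r x -> oball c r y -> x <= z <= y -> oball c r z.
Proof.
rewrite /oball/= !in_itv/= => /andP[? ?] /andP[? ?] /andP[? ?].
by apply/andP; split; lra.
Qed.

(** By induction on the order: the polynomial of [f] is the antiderivative of the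
polynomial of [f'], and the mean value theorem turns the bound for [f'] into a
bound with one more factor [`|x - s|]. Leaving out the factor [1 / m!] keeps the
same constant at every order. *)
Lemma taylor_hoelder (R : realType) (m : nat) (f : R -> R) (c r L a s : R) :
  0 < a -> 0 <= L ->
  derivatives_upto m (oball c r) f ->
  (forall x, oball c r x ->
     `|derive1n m f x - derive1n m f s| <= L * `|x - s| `^ a) ->
  oball c r s ->
  exists q : {poly R}, [/\ (size q <= m.+1)%N, q`_0 = f s &
    forall x, oball c r x ->
      `|f x - q.[x - s]| <= L * `|x - s| `^ a * `|x - s| ^+ m].
Proof.
move=> a0 L0 + + Us; elim: m f => [|m IH] f df hf.
  exists (f s)%:P; split=> [||x Ux]; first exact: size_polyC_leq1.
    by rewrite coefC.
  by rewrite hornerC expr0 mulr1; exact: hf.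
have [||q [sq q0 fq]] := IH (derive1 f).
- move=> k x km Ux; have := df k.+1 x km Ux.
  by rewrite derive1Sn.
- by move=> x Ux; rewrite -!derive1Sn; exact: hf.
have [Q [sQ Q0 dQ]] := antiderivative_poly q (f s).
exists Q; split=> //; first by rewrite (leq_trans sQ)// ltnS.
move=> x Ux.
pose g := f - horner (Q \Po ('X - s%:P)).
have gE y : g y = f y - Q.[y - s].
  by rewrite /g fctE/=; congr (_ - _); rewrite horner_comp hornerXsubC.
have gs : g s = 0 by rewrite gE subrr horner_coef0 Q0 subrr.
have dg y : oball c r y -> is_derive y 1 g (derive1 f y - q.[y - s]).
  move=> Uy; apply: is_deriveB; last first.
    apply: (is_derive_eq (is_derive_poly _ _)).
    by rewrite deriv_comp dQ derivXsubC mulr1 horner_comp hornerXsubC.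
  by apply: DeriveDef; [exact: (df 0%N y)|rewrite derive1E].
have bnd z x1 x2 : oball c r x1 -> oball c r x2 -> x1 <= z <= x2 ->
    `|z - s| <= `|x - s| ->
    `|derive1 f z - q.[z - s]| <= L * `|x - s| `^ a * `|x - s| ^+ m.
  move=> U1 U2 z12 zx; have Uz := oball_itv_sub U1 U2 z12.
  apply: le_trans (fq _ Uz) _; apply: ler_pM.
  - by rewrite mulr_ge0// powR_ge0.
  - by rewrite exprn_ge0.
  - by rewrite ler_wpM2l// ge0_ler_powR// ?nnegrE// ltW.
  - by rewrite lerXn2r// nnegrE.
have cg x1 x2 : oball c r x1 -> oball c r x2 -> {within `[x1, x2], continuous g}.
  move=> U1 U2; apply: derivable_within_continuous => y.
  by rewrite in_itv/= => y12; apply: ex_derive; exact: dg (oball_itv_sub U1 U2 y12).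
have itvW (z x1 x2 : R) : z \in `]x1, x2[ -> x1 <= z <= x2.
  by rewrite in_itv/= => /andP[? ?]; apply/andP; split; apply: ltW.
rewrite -gE exprSr mulrA.
case: (leP s x) => sx.
- have dg' y : y \in `]s, x[ -> is_derive y 1 g (derive1 f y - q.[y - s]).
    by move=> /itvW ysx; apply: dg; exact: oball_itv_sub Us Ux ysx.
  have [z zsx] := MVT_segment sx dg' (cg _ _ Us Ux).
  rewrite gs subr0 => ->; rewrite normrM ler_wpM2r//.
  move: zsx; rewrite in_itv/= => zsx; apply: (bnd _ s x) => //.
  by move/andP: zsx => [? ?]; rewrite !ger0_norm ?subr_ge0// lerB.
- have dg' y : y \in `]x, s[ -> is_derive y 1 g (derive1 f y - q.[y - s]).
    by move=> /itvW ysx; apply: dg; exact: oball_itv_sub Ux Us ysx.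
  have [z zsx] := MVT_segment (ltW sx) dg' (cg _ _ Ux Us).
  rewrite gs sub0r => /(congr1 Num.norm); rewrite normrN => ->.
  rewrite normrM [`|s - x|]distrC ler_wpM2r//.
  move: zsx; rewrite in_itv/= => zsx; apply: (bnd _ x s) => //.
  by move/andP: zsx => [? ?]; rewrite !ler0_norm ?subr_le0 ?(ltW sx)//; lra.
Qed.

(** * Affine change of variables *)

(** Divided by [g], the left-hand side is an image measure of the Lebesgue measure,
so it suffices to compare both sides on half-open intervals. *)
Lemma lebesgue_measure_affine (R : realType) (s g : R) (A : set R) :
  0 < g -> measurable A ->
  (lebesgue_measure ((fun y : R => (y - s) / g)%R @^-1` A) =
   g%:E * lebesgue_measure A)%E.
Proof.
move=> g0 mA.
pose phi : measurableTypeR R -> measurableTypeR R := fun y => (y - s) / g.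
have mphi : measurable_fun setT phi.
  by apply: measurable_funM => //; exact: measurable_funB.
pose image : {measure set (measurableTypeR R) -> \bar R} :=
  measure_function_pushforward__canonical__measure_function_Measure
    lebesgue_measure mphi.
have gV0 : 0 <= g^-1 by rewrite invr_ge0 ltW.
pose nu := mscale (NngNum gV0) image.
have /(_ A mA) : forall A, measurable A -> lebesgue_measure A = nu A.
  apply: lebesgue_measure_unique => _ [[a b]] _ <-.
  rewrite -[RHS]/((g^-1)%:E * lebesgue_measure (phi @^-1` `]a, b]%classic))%E.
  have -> : phi @^-1` `]a, b]%classic = `]g * a + s, g * b + s]%classic.
    apply/seteqP; split=> y; rewrite /= !in_itv/= ltr_pdivlMr// ler_pdivrMr//.
      by move=> /andP[? ?]; apply/andP; split; lra.
    by move=> /andP[? ?]; apply/andP; split; lra.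
  rewrite !lebesgue_measure_itv/= !lte_fin ltrD2r ltr_pM2l//.
  case: ifP => _; last by rewrite mule0.
  rewrite -!EFinD -EFinM; congr EFin.
  by field; rewrite gt_eqF.
move=> /(congr1 (mule g%:E)) H; rewrite {}H.
transitivity (g%:E * ((g^-1)%:E * lebesgue_measure (phi @^-1` A)))%E; last by [].
by rewrite muleA -EFinM divff ?gt_eqF// mul1e.
Qed.

(** Stated for integrable functions, as a kernel of bounded variation can have
jumps. *)
Lemma Rintegral_affine (R : realType) (s g : R) (F : R -> R) :
  0 < g -> lebesgue_measure.-integrable setT (EFin \o F) ->
  lebesgue_measure.-integrable setT (fun y => (F ((y - s) / g))%:E) /\
  \int[lebesgue_measure]_y F ((y - s) / g) = g * \int[lebesgue_measure]_x F x.
Proof.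
move=> g0 iF.
have mF : measurable_fun setT F.
  by apply/measurable_EFinP; exact: measurable_int iF.
pose phi : measurableTypeR R -> measurableTypeR R := fun y => (y - s) / g.
have mphi : measurable_fun setT phi.
  by apply: measurable_funM => //; exact: measurable_funB.
have g0' : 0 <= g by exact: ltW.
have ge0E (h : R -> \bar R) : measurable_fun setT h -> (forall x, (0 <= h x)%E) ->
    (\int[lebesgue_measure]_y h (phi y) = g%:E * \int[lebesgue_measure]_x h x)%E.
  move=> mh h0.
  rewrite -(ge0_integral_mscale lebesgue_measure measurableT (NngNum g0'))//.
  rewrite -[LHS](ge0_integral_pushforward mphi lebesgue_measure measurableT)//.
  apply: eq_measure_integral => A mA _; rewrite /mscale/=.
  exact: lebesgue_measure_affine.
have iphi : lebesgue_measure.-integrable setT (fun y => (F (phi y))%:E).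
  apply/integrableP; split.
    by apply/measurable_EFinP; exact: measurableT_comp.
  rewrite (ge0E (fun x => `|(F x)%:E|%E))//; last first.
    by apply/measurable_EFinP; exact: measurableT_comp.
  by rewrite lte_mul_pinfty//; move/integrableP : iF => [].
split=> //.
have mFE : measurable_fun setT (EFin \o F) by exact: measurable_int iF.
have : (\int[lebesgue_measure]_y (F (phi y))%:E =
        g%:E * \int[lebesgue_measure]_x (F x)%:E)%E.
  transitivity (\int[lebesgue_measure]_y ((EFin \o F)^\+ (phi y)) -
                \int[lebesgue_measure]_y ((EFin \o F)^\- (phi y)))%E.
    rewrite [LHS]integralE; congr (_ - _)%E; apply: eq_integral => y _.
      by rewrite !funeposE.
    by rewrite !funenegE.
  rewrite (ge0E (EFin \o F)^\+%E)//; last exact: measurable_funepos.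
  rewrite (ge0E (EFin \o F)^\-%E)//; last exact: measurable_funeneg.
  rewrite [in RHS]integralE; apply/esym/muleBr => //.
  apply: fin_num_adde_defl; rewrite fin_numN.
  exact: (integrable_neg_fin_num measurableT iF).
rewrite /Rintegral => ->; rewrite fineM//.
exact: integrable_fin_num.
Qed.

Lemma lebesgue_measure_closed_itv (R : realType) (a b : R) : a <= b ->
  lebesgue_measure (`[a, b]%classic : set R) = (b - a)%:E.
Proof.
move=> ab; rewrite lebesgue_measure_itv/= lte_fin; case: ltP => // ba.
by have -> : b = a; [apply/eqP; rewrite eq_le ba ab|rewrite subrr].
Qed.

Lemma bounded_support_integrable (R : realType) (f : R -> R) (a b c : R) :
  a <= b -> measurable_fun setT f -> (forall x, `|f x| <= c) ->
  (forall x, ~ (a <= x <= b) -> f x = 0) ->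
  lebesgue_measure.-integrable setT (EFin \o f) /\
  `|\int[lebesgue_measure]_x f x| <= c * (b - a).
Proof.
move=> ab mf fc f0.
have lab := lebesgue_measure_closed_itv ab.
have iab : lebesgue_measure.-integrable `[a, b] (EFin \o f).
  apply: (@measurable_bounded_integrable _ _ _ lebesgue_measure) => //.
  - by apply: le_lt_trans (ltry (b - a)); rewrite -lab.
  - exact: measurable_funTS.
  - exists c; split => [|d cd]; first exact: num_real.
    by move=> x _; rewrite /= (le_trans (fc x))// ltW.
have fE : f = f \_ `[a, b].
  apply/funext => x; rewrite patchE; case: ifPn => //= xab.
  by rewrite f0// => xab'; move: xab; rewrite notin_setE/= in_itv/=.
have iT : lebesgue_measure.-integrable setT (EFin \o f).
  have mab : measurable (`[a, b]%classic : set (measurableTypeR R)) by [].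
  have H := integrable_mkcond (mu := lebesgue_measure) (EFin \o f) mab.
  have := H.1 iab; rewrite [X in _.-integrable _ X -> _](_ : _ = EFin \o f)//.
  by rewrite {2}fE; apply/funext => x; rewrite !patchE/= patchE; case: ifP.
split=> //; rewrite fE -Rintegral_mkcond.
apply: le_trans (le_normr_Rintegral _ iab) _ => //.
apply: (@le_trans _ _ (\int[lebesgue_measure]_(x in `[a, b]) c)).
  apply: le_Rintegral => //.
  - exact: integrable_norm.
  - apply: (@measurable_bounded_integrable _ _ _ lebesgue_measure) => //.
    + by apply: le_lt_trans (ltry (b - a)); rewrite -lab.
    + exists `|c|; split => [|d cd x _]; first exact: num_real.
      exact: ltW.
by rewrite Rintegral_cst//= lab.
Qed.

(** * Smoothing bias of a kernel *)

Lemma bounded_density_integrable (R : realType) (p : density R) (f : R -> R) (C : R) :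
  measurable_fun setT f -> (forall x, `|f x| <= C) ->
  lebesgue_measure.-integrable setT (fun y => (f y * p y)%:E).
Proof.
move=> mf fC.
have ip : lebesgue_measure.-integrable setT (EFin \o p).
  apply/integrableP; split.
    apply/measurable_EFinP; apply: continuous_measurable_fun.
    exact: pdf_continuous.
  under eq_integral do rewrite /= ger0_norm ?pdf_ge0//.
  by rewrite pdf_integral ltry.
have := @integrableMr _ _ _ lebesgue_measure setT measurableT f (EFin \o p) mf.
apply=> //; exists C; split; first exact: num_real.
by move=> d Cd x _; rewrite /= (le_trans (fC x))// ltW.
Qed.

Section kernel_facts.
Variables (R : realType) (K : R -> R) (c : R).
Hypotheses (kK : is_kernel K) (Kc : forall x, `|K x| <= c).

Lemma kernel_bound_ge0 : 0 <= c.
Proof. by apply: le_trans (Kc 0). Qed.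

Lemma measurable_kernel_affine (s g : R) :
  measurable_fun setT (fun y : R => K ((y - s) / g)).
Proof.
apply: (measurableT_comp (kernel_measurable kK)).
by apply: measurable_funM => //; exact: measurable_funB.
Qed.

Lemma kernel_affine_support (s g y : R) : 0 < g ->
  ~ (s - g <= y <= s + g) -> K ((y - s) / g) = 0.
Proof.
move=> g0 H; apply: kernel_support => //; rewrite ltNge; apply/negP => H1.
apply: H; move: H1; rewrite normrM normfV (gtr0_norm g0) ler_pdivrMr// mul1r.
by rewrite ler_norml => /andP[? ?]; apply/andP; split; lra.
Qed.

Lemma kernel_monomial_integrable (i : nat) :
  lebesgue_measure.-integrable setT (EFin \o (fun x => x ^+ i * K x)).
Proof.
have m1 : -1 <= 1 :> R by lra.
apply: (bounded_support_integrable (c := c) m1 _ _ _).1 => [|x|x x1].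
- by apply: measurable_funM; [exact: exprn_measurable|exact: kernel_measurable].
- have [x1|x1] := leP `|x| 1; last first.
    by rewrite (kernel_support kK x1) mulr0 normr0 kernel_bound_ge0.
  rewrite normrM normrX (le_trans _ (Kc x))//.
  by rewrite ler_piMl// exprn_ile1.
- rewrite (kernel_support kK) ?mulr0// ltNge.
  by apply/negP; rewrite ler_norml.
Qed.

(** The moment conditions kill every monomial of degree between 1 and [l], so that
smoothing a polynomial of degree at most [l] returns its value at the centre. *)
Lemma kernel_polynomial_integral (l : nat) (q : {poly R}) (s g : R) :
  kernel_order K l -> 0 < g -> (size q <= l.+1)%N ->
  lebesgue_measure.-integrable setT
    (fun y : R => (K ((y - s) / g) * q.[y - s])%:E) /\
  \int[lebesgue_measure]_y (K ((y - s) / g) * q.[y - s]) = g * q`_0.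
Proof.
move=> [l1 mom _] g0 sq.
pose F (n : nat) x := \sum_(i < n) q`_i * g ^+ i * (x ^+ i * K x).
have KqF : (fun y => K ((y - s) / g) * q.[y - s]) =
           (fun y => F l.+1 ((y - s) / g)).
  apply/funext => y; rewrite /F (horner_coef_wide _ sq) mulr_sumr.
  apply: eq_bigr => i _; rewrite exprMn exprVn.
  by field; rewrite expf_neq0// gt_eqF.
have FI n : (n <= l)%N -> lebesgue_measure.-integrable setT (EFin \o F n.+1) /\
    \int[lebesgue_measure]_x F n.+1 x = q`_0.
  elim: n => [_|n IH nl].
    have FE : F 1%N = fun x => q`_0 * K x.
      by apply/funext => x; rewrite /F big_ord1/=; ring.
    have K0 : lebesgue_measure.-integrable setT (EFin \o K).
      by have := kernel_monomial_integrable 0; congr (_.-integrable _ _);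
        apply/funext => x /=; rewrite expr0 mul1r.
    rewrite FE; split.
      exact: (integrableZl measurableT q`_0 K0).
    by rewrite RintegralZl// /Rintegral (kernel_integral kK)/= mulr1.
  have [iF vF] := IH (ltnW nl).
  have FE : F n.+2 = F n.+1 \+ (fun x => q`_n.+1 * g ^+ n.+1 * (x ^+ n.+1 * K x)).
    by apply/funext => x; rewrite /F big_ord_recr.
  have iK := kernel_monomial_integrable n.+1.
  have iK' : lebesgue_measure.-integrable setT
     (EFin \o (fun x => q`_n.+1 * g ^+ n.+1 * (x ^+ n.+1 * K x))).
    exact: (integrableZl measurableT (q`_n.+1 * g ^+ n.+1) iK).
  rewrite FE; split; first exact: (integrableD measurableT iF iK').
  rewrite RintegralD// vF RintegralZl//.
  by rewrite /Rintegral -[X in fine X]/(kernel_moment K n.+1) mom//= mulr0 addr0.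
have [iF vF] := FI l (leqnn l).
have [H1 H2] := Rintegral_affine s g0 iF.
split.
  rewrite (_ : (fun y => _) = (fun y => (F l.+1 ((y - s) / g))%:E))//.
  by apply/funext => y; have /(congr1 (fun h => h y)) -> := KqF.
by rewrite KqF H2 vF.
Qed.

(** The polynomial part is reproduced exactly; the remainder contributes at most
its supremum times [c], over a window of length [2 * g]. *)
Lemma kernel_bias (l : nat) (p : density R) (q : {poly R}) (s g D : R) :
  kernel_order K l -> 0 < g -> (size q <= l.+1)%N -> q`_0 = p s ->
  (forall y, s - g <= y <= s + g -> `|p y - q.[y - s]| <= D) ->
  `|\int[lebesgue_measure]_y (K ((y - s) / g) * p y) - g * p s|
    <= 2 * c * D * g.
Proof.
move=> oK g0 sq q0 pq.
have [i1 v1] := kernel_polynomial_integral s oK g0 sq.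
have i2 : lebesgue_measure.-integrable setT (fun y : R => (K ((y - s) / g) * p y)%:E).
  exact: bounded_density_integrable (measurable_kernel_affine s g) (fun=> Kc _).
rewrite -q0 -v1 -RintegralB//.
have sg : s - g <= s + g by lra.
have mb : measurable_fun setT
    (fun x : R => K ((x - s) / g) * p x - K ((x - s) / g) * q.[x - s]).
  apply: measurable_funB; apply/measurable_EFinP.
    exact: measurable_int i2.
  exact: measurable_int i1.
have D0 : 0 <= D by apply: le_trans (pq s _) => //; apply/andP; split; lra.
apply: le_trans (bounded_support_integrable (c := c * D) sg mb _ _).2 _.
- move=> y; rewrite -mulrBr normrM.
  have [ys|/negP/(kernel_affine_support g0) ->] :=
    boolP (s - g <= y <= s + g); first by rewrite ler_pM// pq.
  by rewrite normr0 mul0r mulr_ge0// kernel_bound_ge0.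
- by move=> y ny; rewrite kernel_affine_support// !mul0r subrr.
- by rewrite le_eqVlt; apply/orP; left; apply/eqP; ring.
Qed.

End kernel_facts.

(** * Monotone functions as sums of interval indicators *)

(** Jordan decomposition, on the larger interval from -2 to 2: the kernel vanishes
at -2, so both monotone parts can be normalised to start from 0 there. *)
Lemma kernel_jordan (R : realType) (K : R -> R) : is_kernel K ->
  exists c (H1 H2 : R -> R), 0 < c /\
    (forall x, `|x| <= 1 -> [/\ K x = H1 x - H2 x, 0 <= H1 x <= c & 0 <= H2 x <= c])
    /\ (forall H, H = H1 \/ H = H2 ->
         forall x y, -1 <= x -> x <= y -> y <= 1 -> H x <= H y).
Proof.
move=> kK.
have m2 : -2 <= 2 :> R by lra.
have bv : bounded_variation (-2) 2 K.
  apply/bounded_variationP => //.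
  rewrite ge0_fin_numE ?total_variation_ge0//.
  apply: le_lt_trans (kernel_bounded_variation kK).
  by apply: ereal_sup_ubound; exists (-2, 2).
pose P (f : R -> R) x := fine (neg_tv (-2) f x) - fine (neg_tv (-2) f (-2)).
have Pnd f x y : bounded_variation (-2) 2 f -> -2 <= x -> x <= y -> y <= 2 ->
    P f x <= P f y.
  move=> bf x2 xy y2; rewrite lerB//.
  apply: (fine_neg_tv_nondecreasing bf) => //; rewrite in_itv/=; apply/andP; split; lra.
have bvN := bounded_variationN bv.
have P0 f x : bounded_variation (-2) 2 f -> `|x| <= 1 -> 0 <= P f x.
  rewrite ler_norml => bf /andP[? ?].
  have <- : P f (-2) = 0 by rewrite /P subrr.
  by apply: Pnd => //; lra.
pose c := P (\- K) 2 + P K 2 + 1.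
have P2 f : bounded_variation (-2) 2 f -> 0 <= P f 2.
  move=> bf; have <- : P f (-2) = 0 by rewrite /P subrr.
  exact: Pnd.
exists c, (P (\- K)), (P K); split; last split.
- by have := P2 _ bv; have := P2 _ bvN; rewrite /c; lra.
- move=> x x1; have /andP[x1l x1r] : -1 <= x <= 1 by rewrite -ler_norml.
  split.
  + have KE y : -2 <= y <= 2 ->
        K y = fine (neg_tv (-2) (\- K) y) - fine (neg_tv (-2) K y).
      by move=> y2; apply: (bounded_variation_pos_neg_tvE bv); rewrite in_itv.
    have : K (-2) = 0 by apply: (kernel_support kK); rewrite ltr_normr; lra.
    by rewrite (KE (-2)) ?(KE x) /P; lra.
  + rewrite P0//=; have := Pnd _ x 2 bvN; have := P2 _ bv.
    by rewrite /c; lra.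
  + rewrite P0//=; have := Pnd _ x 2 bv; have := P2 _ bvN.
    by rewrite /c; lra.
- by move=> H [->|->] x y ? ? ?; apply: Pnd => //; lra.
Qed.

(** The sum counts the integers from 1 to [q] that are at most [w]: it is the
integer part of [w], capped at [q]. *)
Lemma unit_step_sum (R : realType) (q : nat) (w : R) : 0 <= w ->
  let S := \sum_(j < q) (j.+1%:R <= w)%R%:R in
  (q%:R <= w -> S = q%:R) /\ (w < q%:R -> S <= w < S + 1).
Proof.
move=> w0 /=; elim: q => [|q [IH1 IH2]].
  by rewrite big_ord0; split=> // w0'; lra.
rewrite big_ord_recr/=; split=> [qw|wq].
  rewrite qw IH1 -?natrD ?addn1// (le_trans _ qw)//.
  by rewrite ler_nat.
rewrite (leNgt q.+1%:R) wq/= addr0; have [qw|] := leP q%:R w; last exact: IH2.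
by rewrite IH1// qw/= -natr1 in wq *.
Qed.

(** Cut the range from 0 to [c] into [q] layers and count the full layers below
[v]. When [v] is the value of a monotone function, each term of the sum is the
indicator of an interval. *)
Lemma step_approximation (R : realType) (q : nat) (c v : R) :
  0 < c -> (0 < q)%N -> 0 <= v <= c ->
  c / q%:R * (\sum_(j < q) (c / q%:R * j.+1%:R <= v)%R%:R) <= v
    <= c / q%:R * (\sum_(j < q) (c / q%:R * j.+1%:R <= v)%R%:R) + c / q%:R.
Proof.
move=> c0 q0 /andP[v0 vc].
have e0 : 0 < c / q%:R by rewrite divr_gt0// ltr0n.
set e := c / q%:R in e0 *.
have ce : c = e * q%:R by rewrite /e divfK// pnatr_eq0 -lt0n.
have vE : v = e * (v / e) by rewrite mulrC divfK// gt_eqF.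
have w0 : 0 <= v / e by rewrite divr_ge0// ltW.
have [] := unit_step_sum q w0.
have -> : \sum_(j < q) (e * j.+1%:R <= v)%R%:R =
          \sum_(j < q) (j.+1%:R <= v / e)%R%:R :> R.
  by apply: eq_bigr => j _; rewrite ler_pdivlMr// mulrC.
set S := \sum_(j < q) _; move: vE w0; move: (v / e) => w vE w0 H1 H2; rewrite vE.
have [wq|wq] := ltP w q%:R.
  have /andP[S1 S2] := H2 wq; rewrite ler_pM2l// S1/=.
  have : e * w <= e * (S + 1) by rewrite ler_pM2l// ltW.
  by rewrite mulrDr mulr1.
have wq' : w = q%:R.
  by apply/eqP; rewrite eq_le wq andbT -(ler_pM2l e0) -ce -vE.
by rewrite (H1 wq) wq' lexx/= lerDl ltW.
Qed.

(** * Discrepancy between a sample and its law *)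

Section discrepancy.
Variables (R : realType) (p : density R) (m : nat) (x : m.-tuple R).
Implicit Types f g : R -> R.

Definition law_integrable f :=
  lebesgue_measure.-integrable setT (fun y => (f y * p y)%:E).

Definition discrepancy f : R :=
  m%:R^-1 * \sum_(i < m) f (tnth x i) - \int[lebesgue_measure]_y (f y * p y).

Lemma bounded_law_integrable f C :
  measurable_fun setT f -> (forall y, `|f y| <= C) -> law_integrable f.
Proof. exact: bounded_density_integrable. Qed.

Lemma indic_law_integrable (A : set R) : measurable A -> law_integrable \1_A.
Proof.
move=> mA; apply: (@bounded_law_integrable _ 1); first exact: measurable_indic.
by move=> y; rewrite indicE; case: (y \in A); rewrite /= ?normr1 ?normr0.
Qed.

Lemma discrepancyD f g : law_integrable f -> law_integrable g ->
  law_integrable (f \+ g) /\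
  discrepancy (f \+ g) = discrepancy f + discrepancy g.
Proof.
move=> lf lg; split.
  rewrite /law_integrable (_ : (fun y => _) =
    (fun y => (f y * p y)%:E) \+ (fun y => (g y * p y)%:E))%E.
    exact: integrableD.
  by apply/funext => y /=; rewrite mulrDl EFinD.
rewrite /discrepancy/= big_split/= (_ : \int[lebesgue_measure]_y _ =
  \int[lebesgue_measure]_y (f y * p y) + \int[lebesgue_measure]_y (g y * p y)).
  by ring.
rewrite -RintegralD//.
by apply: eq_Rintegral => y _; rewrite mulrDl.
Qed.

Lemma discrepancyZ (a : R) f : law_integrable f ->
  law_integrable (fun y => a * f y) /\
  discrepancy (fun y => a * f y) = a * discrepancy f.
Proof.
move=> lf; split.
  rewrite /law_integrable (_ : (fun y => _) =
    (fun y => a%:E * (f y * p y)%:E))%E; first exact: integrableZl.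
  by apply/funext => y /=; rewrite -mulrA EFinM.
rewrite /discrepancy/= -mulr_sumr (_ : \int[lebesgue_measure]_y _ =
  a * \int[lebesgue_measure]_y (f y * p y)); first by ring.
by rewrite -RintegralZl//; apply: eq_Rintegral => y _; rewrite mulrA.
Qed.

Lemma discrepancy_sum (n : nat) (f : 'I_n -> R -> R) (D : R) :
  (forall i, law_integrable (f i)) -> (forall i, `|discrepancy (f i)| <= D) ->
  law_integrable (fun y => \sum_(i < n) f i y) /\
  `|discrepancy (fun y => \sum_(i < n) f i y)| <= n%:R * D.
Proof.
elim: n f => [|n IH] f lf fD.
  have -> : (fun y => \sum_(i < 0) f i y) = cst 0.
    by apply/funext => y; rewrite big_ord0.
  have l0 : law_integrable (cst 0).
    by apply: (@bounded_law_integrable _ 0) => // y; rewrite normr0.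
  split=> //; have [_] := discrepancyZ 0 l0.
  rewrite (_ : (fun y => 0 * _) = cst 0); last by apply/funext => y; rewrite mul0r.
  by rewrite mul0r => ->; rewrite normr0 mul0r.
have [lF dF] := IH (fun i => f (widen_ord (leqnSn n) i))
  (fun i => lf _) (fun i => fD _).
have [lD dD] := discrepancyD lF (lf ord_max).
have -> : (fun y => \sum_(i < n.+1) f i y) =
    (fun y => \sum_(i < n) f (widen_ord (leqnSn n) i) y) \+ f ord_max.
  by apply/funext => y; rewrite big_ord_recr.
split=> //; rewrite dD (le_trans (ler_normD _ _))//.
by rewrite -natr1 mulrDl mul1r lerD.
Qed.

Lemma discrepancy_small f e : law_integrable f -> (forall y, `|f y| <= e) ->
  `|discrepancy f| <= 2 * e.
Proof.
move=> lf fe; have e0 : 0 <= e by apply: le_trans (fe 0).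
have ip : lebesgue_measure.-integrable setT (fun y => (1 * p y)%:E).
  by apply: (@bounded_law_integrable (cst 1) 1) => // y; rewrite normr1.
have I1 : \int[lebesgue_measure]_y (e * p y) = e.
  rewrite RintegralZl//.
    by rewrite /Rintegral pdf_integral mulr1.
  by rewrite (_ : EFin \o p = (fun y => (1 * p y)%:E))//;
    apply/funext => y /=; rewrite mul1r.
have ie : lebesgue_measure.-integrable setT (EFin \o (fun y => e * p y)).
  apply: (@bounded_law_integrable (cst e) e) => // y; by rewrite ger0_norm.
have B2 : `|\int[lebesgue_measure]_y (f y * p y)| <= e.
  rewrite -[leRHS]I1; apply: le_trans (le_normr_Rintegral _ lf) _ => //.
  apply: le_Rintegral => //; first exact: integrable_norm.
  by move=> y _; rewrite normrM (ger0_norm (pdf_ge0 p y)) ler_wpM2r// pdf_ge0.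
have B1 : `|m%:R^-1 * \sum_(i < m) f (tnth x i)| <= e.
  rewrite normrM normfV (ger0_norm (ler0n _ m)).
  have [m0|m0] := posnP m.
    have mR0 : m%:R = 0 :> R by rewrite m0.
    by rewrite mR0 invr0 mul0r.
  rewrite mulrC ler_pdivrMr ?ltr0n//.
  apply: le_trans (ler_norm_sum _ _ _) _.
  apply: (@le_trans _ _ (\sum_(i < m) e)); first exact: ler_sum.
  by rewrite sumr_const card_ord mulr_natr.
by rewrite /discrepancy (le_trans (ler_normB _ _))// mulr_natl mulr2n lerD.
Qed.

End discrepancy.

(** The form in which bounded variation is used: all the randomness of a kernel
estimate is reduced to that of the frequencies of intervals. *)
Definition kernel_deviation_bound (R : realType) (K : R -> R) (c : R)
    (p : density R) (m : nat) (x : m.-tuple R) : Prop :=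
  forall (s g D : R), 0 < g ->
  (forall I : set R, is_interval I -> I `<=` `[s - g, s + g] ->
     `|discrepancy p x \1_I| <= D) ->
  `|discrepancy p x (fun y => K ((y - s) / g))| <= 2 * c * D.

(** Up to a constant, [sqrt (2 ^- j * ln N / N)] is the standard deviation of the
frequency of an interval of length [2 ^- j], inflated by [sqrt (ln N)]. At scales
below [4 * ln N / N] the exponential inequalities degrade. The margin [eps / 2]
leaves room to enlarge the intervals while the density is bounded by [L]. *)
Definition interval_deviation_bound (R : realType) (L eps : R)
    (p : density R) (N : nat) (x : N.-tuple R) : Prop :=
  forall (j : nat) (s : R) (I : set R),
  4 * (ln N%:R / N%:R) <= 2 ^- j :> R ->
  - (eps / 2) <= s - 2 ^- j -> s + 2 ^- j <= 1 + eps / 2 ->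
  is_interval I -> I `<=` `[s - 2 ^- j, s + 2 ^- j] ->
  `|discrepancy p x \1_I|
    <= (11 * L + 5) * Num.sqrt (2 ^- j * (ln N%:R / N%:R)).

(** Each monotone part of the kernel is within [c / q] of [c / q] times a sum of
[q] interval indicators. The discrepancy is linear, so each part contributes at
most [c] times the largest interval discrepancy, up to an error that vanishes as
[q] grows. *)
Lemma kernel_interval_discrepancy (R : realType) (K : R -> R) : is_kernel K ->
  exists c : R, [/\ 0 < c, forall v, `|K v| <= c &
    forall (p : density R) (m : nat) (x : m.-tuple R),
      kernel_deviation_bound K c p x].
Proof.
move=> kK; have [c [H1 [H2 [c0 [HK Hnd]]]]] := kernel_jordan kK.
exists c; have Kc v : `|K v| <= c.
  have [v1|v1] := leP `|v| 1; last by rewrite (kernel_support kK v1) normr0 ltW.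
  have [-> /andP[? ?] /andP[? ?]] := HK _ v1.
  by rewrite ler_norml; apply/andP; split; lra.
split=> // p m x s g D g0 HD.
have D0 : 0 <= D by apply: le_trans (normr_ge0 _) (HD set0 _ _).
have lK : law_integrable p (fun y => K ((y - s) / g)).
  exact: bounded_law_integrable (measurable_kernel_affine kK s g) (fun=> Kc _).
(* The number [q] of layers is free, so the error [4 * c / q] can be made as
   small as desired. *)
suff H (q : nat) : (0 < q)%N ->
    `|discrepancy p x (fun y => K ((y - s) / g))| <= 2 * c * D + 4 * c / q%:R.
  apply/ler_addgt0Pl => e e0.
  pose q := (Num.truncn (4 * c / e)).+1.
  apply: le_trans (H q isT) _; rewrite addrC lerD2r.
  rewrite ler_pdivrMr ?ltr0n// [e * _]mulrC -ler_pdivrMr// ltW//.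
  exact: truncnS_gt.
move=> q0; set e := c / q%:R.
have e0 : 0 < e by rewrite divr_gt0// ltr0n.
pose A (H : R -> R) (j : 'I_q) : set R :=
  [set y | s - g <= y <= s + g /\ e * j.+1%:R <= H ((y - s) / g)].
have phiJ y : s - g <= y <= s + g -> -1 <= (y - s) / g <= 1.
  move=> /andP[? ?]; rewrite ler_pdivlMr// ler_pdivrMr//.
  by apply/andP; split; lra.
have AI H j : H = H1 \/ H = H2 -> is_interval (A H j).
  move=> HH y1 y2 [/andP[a1 a2] a3] [/andP[b1 b2] _] z /andP[yz zy].
  have zJ : s - g <= z <= s + g by apply/andP; split; lra.
  split=> //; apply: le_trans a3 _; apply: (Hnd _ HH).
  - by have /andP[] : -1 <= (y1 - s) / g <= 1 by apply: phiJ; rewrite a1.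
  - by rewrite ler_pM2r ?invr_gt0// lerD2r.
  - by have /andP[] := phiJ _ zJ.
have AS H j : A H j `<=` `[s - g, s + g] by move=> y [+ _]; rewrite /= in_itv.
have S H : H = H1 \/ H = H2 ->
    law_integrable p (fun y => \sum_(j < q) \1_(A H j) y) /\
    `|discrepancy p x (fun y => \sum_(j < q) \1_(A H j) y)| <= q%:R * D.
  move=> HH; apply: (discrepancy_sum (f := fun j => \1_(A H j))) => j.
    by apply: indic_law_integrable; apply: is_interval_measurable; exact: AI.
  by apply: HD => //; exact: AI.
have [l1 d1] := S _ (or_introl erefl).
have [l2 d2] := S _ (or_intror erefl).
have [lZ1 dZ1] := discrepancyZ x e l1.
have [lZ2 dZ2] := discrepancyZ x (- e) l2.
have [l12 d12] := discrepancyD x lZ1 lZ2.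
have [lN12 dN12] := discrepancyZ x (-1) l12.
have [lr dr] := discrepancyD x lK lN12.
set r := _ \+ _ in lr dr.
have re y : `|r y| <= 2 * e.
  rewrite /r/=.
  have [yJ|yJ] := boolP (s - g <= y <= s + g); last first.
    rewrite (kernel_affine_support kK g0) ?add0r; last exact/negP.
    rewrite !big1 => [|j _|j _]; [by rewrite !mulr0 addr0 mulr0 normr0; lra| |];
      by rewrite indicE memNset// => -[yJ' _]; rewrite yJ' in yJ.
  have [KE h1 h2] : [/\ K ((y - s) / g) = H1 ((y - s) / g) - H2 ((y - s) / g),
       0 <= H1 ((y - s) / g) <= c & 0 <= H2 ((y - s) / g) <= c].
    by apply: HK; rewrite ler_norml; exact: phiJ.
  have E H : \sum_(j < q) \1_(A H j) y =
     \sum_(j < q) (e * j.+1%:R <= H ((y - s) / g))%R%:R.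
    apply: eq_bigr => j _; rewrite indicE; congr (nat_of_bool _)%:R.
    by apply/idP/idP => [/set_mem[]//|h]; apply/mem_set.
  rewrite KE !E.
  have /andP[] := step_approximation c0 q0 h1.
  have /andP[] := step_approximation c0 q0 h2.
  rewrite -/e; move: (\sum_(j < q) _) (\sum_(j < q) _) => X Y ? ? ? ?.
  by rewrite ler_norml; apply/andP; split; lra.
have := discrepancy_small x lr re.
rewrite dr dN12 d12 dZ1 dZ2.
have eq : e * q%:R = c by rewrite /e divfK// pnatr_eq0 -lt0n.
have -> : 4 * c / q%:R = 4 * e by rewrite /e mulrA.
move: d1 d2; set a := discrepancy _ _ _; set b := discrepancy _ _ _.
set k := discrepancy _ _ _ => d1 d2 dk.
have ea : `|e * a| <= c * D.
  by rewrite normrM gtr0_norm// -eq -mulrA ler_wpM2l// ltW.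
have eb : `|e * b| <= c * D.
  by rewrite normrM gtr0_norm// -eq -mulrA ler_wpM2l// ltW.
move: ea eb dk; rewrite !ler_norml.
move=> /andP[? ?] /andP[? ?] /andP[? ?]; apply/andP; split; lra.
Qed.

(** * Product laws *)

Section iid_law_facts.
Context {d : measure_display} {T : measurableType d} {R : realType}.
Variable P : probability T R.

(** The integral of a nonnegative function is a supremum over the simple functions
below it, hence monotone among all functions. *)
Lemma le_integral_nonmeasurable (mu : {measure set T -> \bar R}) (f g : T -> \bar R) :
  (forall x, 0 <= f x)%E -> (forall x, f x <= g x)%E ->
  (\int[mu]_x f x <= \int[mu]_x g x)%E.
Proof.
move=> f0 fg; have g0 x : (0 <= g x)%E by apply: le_trans (fg x).
rewrite !ge0_integralTE//; apply: le_ereal_sup => _ [h /= hf <-].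
by exists h => // x; exact: le_trans (hf x) (fg x).
Qed.

(** A product measure is an iterated integral, which is monotone on arbitrary sets:
an event can be bounded through any measurable event that contains it. *)
Lemma le_iid_law (m : nat) (A B : set (m.-tuple T)) :
  A `<=` B -> (iid_law P m A <= iid_law P m B)%E.
Proof.
elim: m A B => [|m IH] A B AB.
  rewrite -![iid_law P 0 _]/(\d_([tuple] : 0.-tuple T) _) !diracE lee_fin ler_nat.
  case: (boolP (_ \in A)) => // /set_mem/AB Bx.
  by rewrite mem_set.
apply: le_integral_nonmeasurable => x /=; first exact: measure_ge0.
by apply: IH => z /xsectionP/AB Bz; apply/xsectionP.
Qed.

(** This is the way independence enters exponential inequalities. *)
Lemma iid_law_prod_le (m : nat) (f : T -> R) (a : R) :
  measurable_fun setT f -> (forall y, 0 <= f y) -> 0 <= a ->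
  (\int[P]_y (f y)%:E <= a%:E)%E ->
  (\int[iid_law P m]_x (\prod_(i < m) f (tnth x i))%:E <= (a ^+ m)%:E)%E.
Proof.
move=> mf f0 a0 fa.
have mprod n : measurable_fun setT
    (fun x : n.-tuple T => \prod_(i < n) f (tnth x i)).
  apply: measurable_prod => i _.
  by apply: measurableT_comp => //; exact: measurable_tnth.
have prod0 n (x : n.-tuple T) : 0 <= \prod_(i < n) f (tnth x i).
  by apply: prodr_ge0.
elim: m => [|m IH].
  under eq_integral do rewrite big_ord0.
  rewrite integral_cst// mul1e expr0.
  exact: (probability_le1 (iid_law P 0) measurableT).
have mcons : measurable_fun setT (@tuple_cons d T m) by exact: measurable_funP.
rewrite (ge0_integral_pushforward mcons)//; last 2 first.
- by apply/measurable_EFinP; exact: mprod.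
- by move=> x _; rewrite lee_fin prod0.
rewrite preimage_setT (fubini_tonelli1 (m1 := P) (m2 := iid_law P m))/=; last 2 first.
- by apply/measurable_EFinP; exact: (measurableT_comp (mprod m.+1) mcons).
- by move=> x; rewrite lee_fin prod0.
rewrite /fubini_F/=.
have E x : (\int[iid_law P m]_y
      (\prod_(i < m.+1) f (tnth (tuple_cons (x, y)) i))%:E =
    (f x)%:E * \int[iid_law P m]_y (\prod_(i < m) f (tnth y i))%:E)%E.
  rewrite -ge0_integralZl//; last 3 first.
  - by apply/measurable_EFinP; exact: mprod.
  - by move=> y _; rewrite lee_fin prod0.
  - by rewrite lee_fin.
  apply: eq_integral => y _; rewrite -EFinM big_ord_recl; congr (_ * _)%:E.
  by apply: eq_bigr => i _; congr f; exact: tnthS.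
under eq_integral do rewrite E.
apply: (@le_trans _ _ (\int[P]_x ((f x)%:E * (a ^+ m)%:E))%E).
  apply: ge0_le_integral => //.
  - move=> x _; rewrite mule_ge0// ?lee_fin// integral_ge0// => y _.
    by rewrite lee_fin prod0.
  - by apply: emeasurable_funM => //; exact/measurable_EFinP.
  - by apply: emeasurable_funM => //; exact/measurable_EFinP.
  - by move=> x _; rewrite lee_wpmul2l// lee_fin.
rewrite ge0_integralZr//; last 3 first.
- by apply/measurable_EFinP.
- by move=> x _; rewrite lee_fin.
- by rewrite lee_fin exprn_ge0.
by rewrite exprS EFinM lee_wpmul2r// lee_fin exprn_ge0.
Qed.

End iid_law_facts.

(** * Chernoff bounds for frequencies *)

(** The tangent bound [1 - u <= expR (- u)] gives [expR u <= 1 / (1 - u)], which is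
below the quadratic on this range. *)
Lemma expR_le_quadratic (R : realType) (u : R) :
  `|u| <= 2^-1 -> expR u <= 1 + u + 2 * u ^+ 2.
Proof.
move=> u2; have /andP[u2l u2r] : - 2^-1 <= u <= 2^-1 by rewrite -ler_norml.
have e0 : 0 < 1 - u by lra.
have := expR_ge1Dx (- u); rewrite expRN -[X in _ <= X]div1r.
rewrite ler_pdivlMr ?expR_gt0// mulrC -ler_pdivlMr//.
move=> /le_trans; apply; rewrite ler_pdivrMr//.
have : 0 <= u ^+ 2 * (1 - 2 * u) by rewrite mulr_ge0 ?sqr_ge0//; lra.
by rewrite -subr_ge0 => h; rewrite -subr_ge0; move: h; congr (0 <= _); ring.
Qed.

Section count_deviation.
Context {d : measure_display} {T : measurableType d} {R : realType}.
Variables (P : probability T R) (m : nat).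

Definition count_in (A : set T) (x : m.-tuple T) : R :=
  \sum_(i < m) \1_A (tnth x i).

Lemma measurable_count (A : set T) :
  measurable A -> measurable_fun setT (count_in A).
Proof.
move=> mA; apply: measurable_sum => i.
by apply: measurableT_comp; [exact: measurable_indic|exact: measurable_tnth].
Qed.

Lemma measurable_count_superlevel (A : set T) (a t q : R) : measurable A ->
  measurable [set x | t <= a * (count_in A x - q)].
Proof.
move=> mA.
have mdev : measurable_fun setT (fun x => a * (count_in A x - q)).
  by apply: measurable_funM => //; apply: measurable_funB => //; exact: measurable_count.
rewrite (_ : [set x | _] =
    setT `&` (fun x => a * (count_in A x - q)) @^-1` `[t, +oo[).
  exact: mdev.
by rewrite setTI; apply/seteqP; split=> x /=; rewrite in_itv/= andbT.
Qed.

Lemma probabilityE (A : set T) : measurable A -> P A = (fine (P A))%:E.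
Proof. by move=> mA; rewrite fineK// fin_num_measure. Qed.

Lemma indic_mgf (A : set T) (a : R) : measurable A ->
  (\int[P]_y (expR (a * \1_A y))%:E =
   (1 + fine (P A) * (expR a - 1))%:E)%E.
Proof.
move=> mA; have mCA : measurable (~` A) by exact: measurableC.
have -> : (fun y => (expR (a * \1_A y))%:E) =
    (fun y => (\1_(~` A) y)%:E + (expR a)%:E * (\1_A y)%:E)%E.
  apply/funext => y; rewrite !indicE in_setC -EFinM -EFinD; congr EFin.
  by case: (y \in A) => /=; rewrite ?mulr1 ?mulr0 ?expR0; ring.
rewrite ge0_integralD//; last 2 first.
- by apply/measurable_EFinP; exact: measurable_indic.
- by apply: emeasurable_funM => //; apply/measurable_EFinP; exact: measurable_indic.
rewrite ge0_integralZl ?lee_fin ?expR_ge0//; last first.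
  by apply/measurable_EFinP; exact: measurable_indic.
rewrite !integral_indic// !setIT.
transitivity (1 - P A + (expR a)%:E * P A)%E.
  by congr (_ + _)%E; exact: probability_setC.
rewrite (probabilityE mA)/=.
by rewrite -EFinB -EFinM -EFinD; congr EFin; ring.
Qed.

(** Markov's inequality for the exponential of [a] times the count; the sign of [a]
selects the tail. If [q] is the probability of [A], the moment generating
function of its indicator is at most [expR (q * (a + 2 * a ^+ 2))]. The quadratic
term keeps the factor [q], which makes deviations shrink with the length of an
interval. *)
Lemma chernoff_count (A : set T) (a t : R) : measurable A -> `|a| <= 2^-1 ->
  (iid_law P m [set x | (t <= a * (count_in A x - m%:R * fine (P A)))%R]
   <= (expR (2 * m%:R * fine (P A) * a ^+ 2 - t))%:E)%E.
Proof.
move=> mA a2; set q := fine (P A); set S := [set x | _].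
have q0 : 0 <= q by rewrite fine_ge0.
have mS : measurable S by exact: measurable_count_superlevel.
pose f y := expR (a * \1_A y).
have mf : measurable_fun setT f.
  by apply: measurableT_comp => //; apply: measurable_funM => //; exact: measurable_indic.
have Ff x : \prod_(i < m) f (tnth x i) = expR (a * count_in A x).
  by rewrite /count_in mulr_sumr expR_sum.
pose b := 1 + q * (expR a - 1).
have mg := indic_mgf a mA.
have b0 : 0 <= b.
  rewrite -lee_fin -mg; apply: integral_ge0 => y _.
  by rewrite lee_fin expR_ge0.
have ub : b <= expR (q * (a + 2 * a ^+ 2)).
  apply: le_trans (expR_ge1Dx _); rewrite lerD2l ler_wpM2l//.
  by have := expR_le_quadratic a2; lra.
have := @iid_law_prod_le _ _ _ P m f b mf (fun=> expR_ge0 _) b0.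
rewrite mg lexx => /(_ isT) Fb.
have mF : measurable_fun setT (fun x : m.-tuple T => expR (a * count_in A x)).
  by apply: measurableT_comp => //; apply: measurable_funM => //; exact: measurable_count.
pose u := t + a * (m%:R * q).
apply: (@le_trans _ _ (\int[iid_law P m]_x
    ((expR (- u))%:E * (expR (a * count_in A x))%:E))%E).
  rewrite -[X in iid_law P m X]setIT -integral_indic//.
  apply: ge0_le_integral => //.
  - by apply/measurable_EFinP; exact: measurable_indic.
  - by apply: emeasurable_funM => //; exact/measurable_EFinP.
  - move=> x _; rewrite -EFinM lee_fin -expRD indicE.
    case: (boolP (x \in S)) => [/set_mem Sx|_] /=; last exact: expR_ge0.
    by rewrite -expR0 ler_expR /u; move: Sx; rewrite /S/= mulrBr; lra.
rewrite ge0_integralZl ?lee_fin ?expR_ge0//; last first.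
  exact/measurable_EFinP.
under eq_integral do rewrite -Ff.
apply: (@le_trans _ _ ((expR (- u))%:E * (b ^+ m)%:E)%E).
  by rewrite lee_wpmul2l// lee_fin expR_ge0.
rewrite -EFinM lee_fin.
apply: (@le_trans _ _ (expR (- u) * expR (q * (a + 2 * a ^+ 2)) ^+ m)).
  by rewrite ler_wpM2l ?expR_ge0// lerXn2r// nnegrE expR_ge0.
rewrite -expRM_natl -expRD ler_expR le_eqVlt; apply/orP; left; apply/eqP.
by rewrite /u -mulr_natl; ring.
Qed.

Lemma count_deviation (A : set T) (a e v : R) :
  measurable A -> 0 < a -> a <= 2^-1 ->
  2 * m%:R * fine (P A) * a ^+ 2 - a * m%:R * e <= - v ->
  exists B, [/\ measurable B, (iid_law P m B <= (2 * expR (- v))%:E)%E &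
    forall x, ~ B x -> `|m%:R^-1 * count_in A x - fine (P A)| <= e].
Proof.
move=> mA a0 a2 av; set q := fine (P A) in av *.
pose S (z : R) := [set x | a * m%:R * e <= z * (count_in A x - m%:R * q)].
have mS z : measurable (S z) by exact: measurable_count_superlevel.
exists (S a `|` S (- a)); split.
- exact: measurableU.
- apply: le_trans (measureU2 _ (mS _) (mS _)) _.
  rewrite mulr_natl mulr2n EFinD; apply: leeD.
    apply: le_trans (chernoff_count _ mA _) _; first by rewrite gtr0_norm.
    by rewrite lee_fin ler_expR.
  apply: le_trans (chernoff_count _ mA _) _; first by rewrite normrN gtr0_norm.
  by rewrite lee_fin ler_expR sqrrN.
- move=> x /not_orP[/negP + /negP]; rewrite /S/= -!ltNge mulNr => h1 h2.
  have [m0|m0] := posnP m.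
    have q0 : 0 <= q by rewrite fine_ge0.
    exfalso; move: h1; rewrite /count_in.
    have mR0 : m%:R = 0 :> R by rewrite m0.
    rewrite mR0 !mulr0 !mul0r subr0 big1 ?mulr0 ?ltxx// => i _.
    by have := ltn_ord i; rewrite {2}m0.
  have m0' : 0 < m%:R :> R by rewrite ltr0n.
  have -> : m%:R^-1 * count_in A x - q = (count_in A x - m%:R * q) / m%:R.
    by field; rewrite gt_eqF.
  rewrite normrM normfV (gtr0_norm m0') ler_pdivrMr//.
  rewrite -(ler_pM2l a0) -{1}(gtr0_norm a0) -normrM ler_norml.
  by apply/andP; split; lra.
Qed.

Lemma finite_count_deviation (J : finType) (A : J -> set T) (a e : J -> R) (v : R) :
  (forall j, [/\ measurable (A j), 0 < a j, a j <= 2^-1 &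
    2 * m%:R * fine (P (A j)) * a j ^+ 2 - a j * m%:R * e j <= - v]) ->
  exists B, [/\ measurable B,
    (iid_law P m B <= (#|J|%:R * (2 * expR (- v)))%:E)%E &
    forall x, ~ B x -> forall j, `|m%:R^-1 * count_in (A j) x - fine (P (A j))| <= e j].
Proof.
move=> H; have {H}/choice[B HB] : forall j, exists B, [/\ measurable B,
    (iid_law P m B <= (2 * expR (- v))%:E)%E &
    forall x, ~ B x -> `|m%:R^-1 * count_in (A j) x - fine (P (A j))| <= e j].
  by move=> j; have [? ? ? ?] := H j; apply: (@count_deviation (A j) (a j)).
have mB j : measurable (B j) by have [] := HB j.
exists (\big[setU/set0]_(j <- enum J) B j); split.
- exact: bigsetU_measurable.
- rewrite cardE; elim: (enum J) => [|j s IH].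
    by rewrite big_nil measure0 mul0r.
  rewrite big_cons; apply: le_trans (measureU2 _ _ _) _ => //.
    exact: bigsetU_measurable.
  rewrite /= -[X in X%:R]add1n natrD mulrDl mul1r EFinD; apply: leeD => //.
  by have [] := HB j.
- move=> x nB j; have [_ _] := HB j; apply => Bj; apply: nB.
  have : j \in enum J by rewrite mem_enum.
  elim: (enum J) => // k s IH; rewrite inE big_cons => /orP[/eqP <-|/IH]; first by left.
  by right.
Qed.

End count_deviation.

(** * Uniform deviations over intervals *)

Lemma discrepancy_indic (R : realType) (p : density R) (m : nat)
    (x : m.-tuple R) (A : set R) : measurable A ->
  discrepancy p x \1_A =
    m%:R^-1 * count_in (T := measurableTypeR R) A x - fine (law p A).
Proof.
move=> mA; rewrite /discrepancy; congr (_ - _).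
rewrite /Rintegral /law [in RHS]integral_mkcond epatch_indic.
congr fine; apply: eq_integral => y _ /=.
by rewrite mulrC EFinM.
Qed.

Lemma law_itv_le (R : realType) (p : density R) (L a b : R) :
  a <= b -> (forall x, a <= x <= b -> p x <= L) ->
  fine (law p `[a, b]) <= L * (b - a).
Proof.
move=> ab pL.
have m_ab : measurable (`[a, b]%classic : set (measurableTypeR R)) by [].
have lab := lebesgue_measure_closed_itv ab.
rewrite -lee_fin -(probabilityE (law p) m_ab) EFinM -lab.
have L0 : 0 <= L by apply: le_trans (pdf_ge0 p a) (pL a _); rewrite lexx.
rewrite -[X in (_ <= X)%E]integral_cst//.
apply: ge0_le_integral => //.
- by move=> x _; rewrite lee_fin pdf_ge0.
- apply/measurable_EFinP; apply: measurable_funTS.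
  by apply: continuous_measurable_fun; exact: pdf_continuous.
Qed.

Section grid_deviation.
Variables (R : realType) (p : density R) (L eps : R) (N : nat).
Hypotheses (L0 : 0 < L) (N0 : (0 < N)%N) (lN : 1 <= ln N%:R :> R).
Hypothesis pL : forall x, - eps < x < 1 + eps -> p x <= L.

(** Multiples of [1 / N], indexed by natural numbers from -1 on, so as to cover
the interval from [- eps] to [1 + eps]. *)
Let grid_point (i : nat) : R := i%:R / N%:R - 1.

Let rate : R := ln N%:R / N%:R.

Let N0' : 0 < N%:R :> R. Proof. by rewrite ltr0n. Qed.

Let grid_itv (i k : nat) : set R := `[grid_point i, grid_point k]%classic.

Let law_grid_itv (i k : nat) : (i <= k)%N ->
  - eps < grid_point i -> grid_point k < 1 + eps ->
  fine (law p (grid_itv i k)) <= L * ((k - i)%:R / N%:R).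
Proof.
move=> ik hi hk.
have ik' : i%:R / N%:R <= k%:R / N%:R :> R by rewrite ler_pM2r ?invr_gt0// ler_nat.
have gik : grid_point i <= grid_point k by rewrite /grid_point lerD2r.
have gL x : grid_point i <= x <= grid_point k -> p x <= L.
  move=> /andP[? ?]; apply: pL; apply/andP; split.
    exact: lt_le_trans hi _.
  exact: le_lt_trans hk.
apply: le_trans (law_itv_le gik gL) _.
by rewrite natrB// /grid_point ler_pM2l// mulrBl; lra.
Qed.

(** For intervals of length O(g) with [g = 2 ^- j], Chernoff's inequality is used
with parameter [sqrt (rate / g)]: the variance term is at most [8 * L * ln N] and
the linear term is [(8 * L + 5) * ln N], so a single deviation has probability at
most [2 * N ^- 5]. There are at most [16 * N ^ 3] choices of end points and scale. *)
Lemma grid_deviation :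
  exists B : set (N.-tuple (measurableTypeR R)), [/\ measurable B,
    (iid_law (law p) N B <= (32 / N%:R ^+ 2)%:E)%E &
    forall x : N.-tuple R, ~ B x -> forall i k j : nat,
      (i <= 3 * N)%N -> (k <= 3 * N)%N -> - eps < grid_point i ->
      grid_point k < 1 + eps ->
      grid_point k - grid_point i <= 4 * 2 ^- j -> 4 * rate <= 2 ^- j ->
      `|discrepancy p x \1_(grid_itv i k)|
        <= (8 * L + 5) * Num.sqrt (2 ^- j * rate)].
Proof.
have r0 : 0 < rate by rewrite divr_gt0// (lt_le_trans ltr01).
pose J : finType := ('I_(3 * N).+1 * 'I_(3 * N).+1 * 'I_N)%type.
pose g (j : J) : R := 2 ^- j.2.
have g0 j : 0 < g j by rewrite invr_gt0 exprn_gt0.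
pose C (j : J) := [&& - eps < grid_point j.1.1, grid_point j.1.2 < 1 + eps,
   grid_point j.1.2 - grid_point j.1.1 <= 4 * g j & 4 * rate <= g j].
(* Triples that violate the constraints get the empty set, with values of the
   parameter and of the threshold for which the bound is trivial. *)
pose A (j : J) : set (measurableTypeR R) :=
  if C j then grid_itv j.1.1 j.1.2 else set0.
pose a (j : J) := if C j then Num.sqrt (rate / g j) else 2^-1.
pose e (j : J) := if C j then (8 * L + 5) * Num.sqrt (g j * rate)
                  else 10 * rate.
have NR : N%:R * rate = ln N%:R by rewrite /rate mulrC divfK// gt_eqF.
have [|B [mB PB HB]] := @finite_count_deviation _ _ _ (law p) N J A a e (5 * ln N%:R).
  move=> j; rewrite /A /a /e; case: ifPn => [/and4P[c1 c2 c3 c4]|_]; last first.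
    split=> //; rewrite measure0/= mulr0 mul0r.
    have -> : 2^-1 * N%:R * (10 * rate) = 5 * (N%:R * rate) by field.
    by rewrite NR sub0r.
  have rg : rate / g j <= 4^-1 by rewrite ler_pdivrMr//; lra.
  have rg0 : 0 < rate / g j by rewrite divr_gt0.
  split.
  - exact: measurable_itv.
  - by rewrite sqrtr_gt0.
  - have -> : 2^-1 = Num.sqrt (2^-1 ^+ 2) :> R by rewrite sqrtr_sqr ger0_norm.
    rewrite ler_wsqrtr// (le_trans rg)//.
    by have -> : 2^-1 ^+ 2 = 4^-1 :> R by field.
  - rewrite sqr_sqrtr ?(ltW rg0)//.
    have sq : Num.sqrt (rate / g j) * Num.sqrt (g j * rate) = rate.
      rewrite -sqrtrM ?(ltW rg0)// -[RHS](ger0_norm (ltW r0)) -sqrtr_sqr.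
      by congr Num.sqrt; field; rewrite gt_eqF.
    have P4 : fine (law p (grid_itv j.1.1 j.1.2)) <= 4 * L * g j.
      have [ik|ki] := leqP j.1.1 j.1.2.
        apply: le_trans (law_grid_itv ik c1 c2) _.
        have -> : 4 * L * g j = L * (4 * g j) by ring.
        rewrite ler_pM2l//; apply: le_trans c3.
        by rewrite natrB// /grid_point mulrBl; lra.
      rewrite /grid_itv set_itv_ge; first by rewrite measure0/= !mulr_ge0// ltW.
      by rewrite bnd_simp -ltNge /grid_point ltrD2r ltr_pM2r ?invr_gt0// ltr_nat.
    have -> : Num.sqrt (rate / g j) * N%:R *
        ((8 * L + 5) * Num.sqrt (g j * rate)) = (8 * L + 5) * ln N%:R.
      by rewrite -NR -[in RHS]sq; ring.
    have : 2 * N%:R * fine (law p (grid_itv j.1.1 j.1.2)) * (rate / g j) <=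
        2 * N%:R * (4 * L * g j) * (rate / g j).
      by rewrite ler_wpM2r ?(ltW rg0)// ler_wpM2l.
    have -> : 2 * N%:R * (4 * L * g j) * (rate / g j) = 8 * L * ln N%:R.
      by rewrite -NR; field; rewrite gt_eqF.
    by lra.
exists B; split=> //.
- apply: le_trans PB _; rewrite lee_fin.
  have -> : #|J| = ((3 * N).+1 * (3 * N).+1 * N)%N by rewrite !card_prod !card_ord.
  have -> : expR (- (5 * ln N%:R)) = (N%:R ^+ 5)^-1 :> R.
    by rewrite expRN mulrC expRM_natr lnK// posrE.
  have N3 : (3 * N).+1%:R <= 4 * N%:R :> R.
    by rewrite -natrM ler_nat (mulSnr 3) -addn1 leq_add2l.
  rewrite !natrM.
  apply: (@le_trans _ _ (4 * N%:R * (4 * N%:R) * N%:R * (2 * (N%:R ^+ 5)^-1))).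
    apply: ler_wpM2r; first by rewrite mulr_ge0// invr_ge0 exprn_ge0.
    by apply: ler_wpM2r => //; apply: ler_pM.
  rewrite le_eqVlt; apply/orP; left; apply/eqP; field.
  by rewrite gt_eqF.
- move=> x nB i k j i3 k3 ci ck cik cj.
  have jN : (j < N)%N.
    have h : 2%:R ^+ j <= N%:R :> R.
      have : 4 * rate * N%:R <= 2 ^- j * N%:R by rewrite ler_pM2r.
      have -> : 4 * rate * N%:R = 4 * ln N%:R by rewrite -NR; ring.
      rewrite [2 ^- j * _]mulrC ler_pdivlMr ?exprn_gt0// => h.
      apply: le_trans h; rewrite ler_peMl ?exprn_ge0//.
      by move: lN; lra.
    by move: h; rewrite -natrX ler_nat; apply: leq_trans; exact: ltn_expl.
  pose t : J := (Ordinal (n := (3 * N).+1) (m := i) i3,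
                 Ordinal (n := (3 * N).+1) (m := k) k3, Ordinal jN).
  have Ct : C t by apply/and4P; split.
  have := HB x nB t; rewrite /A /e Ct => H.
  rewrite discrepancy_indic; first exact: H.
  exact: measurable_itv.
Qed.

End grid_deviation.

Lemma count_in_mono (R : realType) (T : Type) (m : nat) (x : m.-tuple T) (A B : set T) :
  A `<=` B -> \sum_(i < m) \1_A (tnth x i) <= \sum_(i < m) \1_B (tnth x i) :> R.
Proof.
move=> AB; apply: ler_sum => i _; rewrite !indicE ler_nat.
by case: (boolP (_ \in A)) => // /set_mem/AB h; rewrite mem_set.
Qed.

(** An interval is bracketed by two grid intervals whose probabilities differ by at
most [3 * L / N], and [1 / N] is below the noise level. *)
Lemma interval_deviation (R : realType) (p : density R) (L eps : R) (N : nat) :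
  0 < L -> 0 < eps < 1 -> (0 < N)%N -> 1 <= ln N%:R :> R ->
  4 < eps * N%:R ->
  (forall x, - eps < x < 1 + eps -> p x <= L) ->
  exists B : set (N.-tuple (measurableTypeR R)), [/\ measurable B,
    (iid_law (law p) N B <= (32 / N%:R ^+ 2)%:E)%E &
    forall x : N.-tuple R, ~ B x -> interval_deviation_bound L eps p x].
Proof.
move=> L0 eps01 N0 lN epsN pL.
have [e0 e1] := andP eps01.
have [B [mB PB HB]] := grid_deviation L0 N0 lN pL.
exists B; split=> // x nB j s I.
set r : R := ln N%:R / N%:R; set g : R := 2 ^- j => gr sl sr iI Is.
have N0' : 0 < N%:R :> R by rewrite ltr0n.
pose eta : R := N%:R^-1.
have eta0 : 0 < eta by rewrite invr_gt0.
have etar : eta <= r.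
  by rewrite /eta /r -[leLHS]mul1r ler_wpM2r// ltW.
have eps_eta : 4 * eta < eps by rewrite /eta ltr_pdivrMr// mulrC.
have g0 : 0 < g by rewrite invr_gt0 exprn_gt0.
have etaS : eta <= Num.sqrt (g * r).
  rewrite -[leLHS](ger0_norm (ltW eta0)) -sqrtr_sqr ler_wsqrtr// expr2.
  by apply: ler_pM => //; [exact: ltW|exact: ltW|lra].
have S0 : 0 <= Num.sqrt (g * r) by exact: sqrtr_ge0.
have [->|/set0P[z Iz]] := eqVneq I set0.
  rewrite discrepancy_indic// measure0 /count_in big1 ?mulr0 ?subrr ?normr0.
    by rewrite mulr_ge0//; lra.
  by move=> i _; rewrite indicE in_set0.
have IsE y : I y -> s - g <= y <= s + g by move/Is; rewrite /= in_itv.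
have hsup : has_sup I by split; [exists z|exists (s + g) => y /IsE/andP[]].
have hinf : has_inf I by split; [exists z|exists (s - g) => y /IsE/andP[]].
set a := inf I; set b := sup I.
have sa : s - g <= a by apply: lb_le_inf; [exists z|move=> y /IsE/andP[]].
have bs : b <= s + g by apply: ge_sup; [exists z|move=> y /IsE/andP[]].
have Iab y : I y -> a <= y <= b.
  by move=> Iy; rewrite (inf_lbound hinf.2 Iy) (sup_ubound hsup.2 Iy).
have abI y : a < y -> y < b -> I y.
  move=> ay yb; have [y1 Iy1 y1y] := inf_lt hinf.1 ay.
  have [y2 Iy2 y2y] := sup_gt hsup.1 yb.
  by apply: (iI y1 y2) => //; rewrite !ltW.
have ab : a <= b by have /andP[? ?] := Iab _ Iz; lra.
pose pt (i : nat) : R := i%:R / N%:R - 1.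
have ptS i : pt i.+1 = pt i + eta by rewrite /pt /eta -natr1 mulrDl mul1r; ring.
have ptP c : 0 <= c + 1 -> exists i, pt i <= c < pt i.+1.
  move=> c0; have cN : 0 <= (c + 1) * N%:R by rewrite mulr_ge0// ltW.
  exists (Num.truncn ((c + 1) * N%:R)).
  have /andP[h1 h2] := truncn_itv cN.
  by rewrite /pt lerBlDr ler_pdivrMr// h1/= ltrBrDr ltr_pdivlMr.
have [|i /andP[ia ai]] := ptP a; first by lra.
have [|k' /andP[kb bk]] := ptP b; first by lra.
have [k kE] : exists k, k' = k.+1.
  case: k' kb bk => [|k' _ _]; last by exists k'.
  by rewrite ptS /pt mul0r; lra.
subst k'; rewrite !ptS in ai kb bk.
have pt_lt c : pt c < 1 + eps -> (c <= 3 * N)%N.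
  rewrite /pt ltrBlDr ltr_pdivrMr// => h.
  have : c%:R < 3 * N%:R :> R by apply: lt_le_trans h _; rewrite ler_pM2r//; lra.
  by rewrite -natrM ltr_nat => /ltnW.
have mI := is_interval_measurable iI.
(* The inner interval ends at [pt k], one step before the last grid point
   below [b], because [b] itself may lie outside [I]. *)
pose O : set (measurableTypeR R) := `[pt i, pt k.+2]%classic.
pose J : set (measurableTypeR R) := `[pt i.+1, pt k]%classic.
have IO : I `<=` O.
  by move=> y /Iab/andP[? ?]; rewrite /O/= in_itv/= !ptS; apply/andP; split; lra.
have JI : J `<=` I.
  move=> y; rewrite /J/= in_itv/= ptS => /andP[? ?]; apply: abI; lra.
have mO : measurable O by exact: measurable_itv.
have mJ : measurable J by exact: measurable_itv.
have hG u v : - eps < pt u -> pt v < 1 + eps -> pt u < 1 + eps ->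
    pt v - pt u <= 4 * g ->
    `|discrepancy p x \1_(`[pt u, pt v]%classic)| <= (8 * L + 5) * Num.sqrt (g * r).
  by move=> h1 h2 h3 h4; apply: (HB x nB u v j) => //; exact: pt_lt.
have hO : `|discrepancy p x \1_O| <= (8 * L + 5) * Num.sqrt (g * r).
  move: ai kb bk ia eps_eta sa bs sl sr etar gr eta0 ab.
  by clear -hG ptS => *; apply: hG; rewrite ?ptS; lra.
have hJ : `|discrepancy p x \1_J| <= (8 * L + 5) * Num.sqrt (g * r).
  move: ai kb bk ia eps_eta sa bs sl sr etar gr eta0 ab.
  by clear -hG ptS => *; apply: hG; rewrite ?ptS; lra.
have cIO := @count_in_mono R _ _ x I O IO.
have cJI := @count_in_mono R _ _ x J I JI.
have finE A : measurable A -> law p A = (fine (law p A))%:E.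
  exact: (probabilityE (law p)).
have lIO : fine (law p I) <= fine (law p O).
  by rewrite -lee_fin -!finE//; apply: le_measure => //; rewrite inE.
have lJI : fine (law p J) <= fine (law p I).
  by rewrite -lee_fin -!finE//; apply: le_measure => //; rewrite inE.
have lE : fine (law p O) <= fine (law p J) + 3 * L * eta.
  pose E1 : set (measurableTypeR R) := `[pt i, pt i.+1]%classic.
  pose E2 : set (measurableTypeR R) := `[pt k, pt k.+2]%classic.
  have mE1 : measurable E1 by exact: measurable_itv.
  have mE2 : measurable E2 by exact: measurable_itv.
  have OE : O `<=` E1 `|` (J `|` E2).
    move=> y; rewrite /O /E1 /J /E2/= !in_itv/= => /andP[h1 h2].
    have [|y1] := leP y (pt i.+1); first by left; rewrite h1.
    have [|y2] := leP y (pt k); first by right; left; rewrite ltW.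
    by right; right; rewrite (ltW y2).
  have l1 : fine (law p E1) <= L * (pt i.+1 - pt i).
    apply: law_itv_le; first by rewrite ptS; lra.
    by move=> y /andP[]; rewrite ptS => ? ?; apply: pL; apply/andP; split; lra.
  have l2 : fine (law p E2) <= L * (pt k.+2 - pt k).
    apply: law_itv_le; first by rewrite !ptS; lra.
    by move=> y /andP[]; rewrite !ptS => ? ?; apply: pL; apply/andP; split; lra.
  have : fine (law p O) <= fine (law p E1) + (fine (law p J) + fine (law p E2)).
    rewrite -lee_fin !EFinD -!finE//.
    have mU : measurable (E1 `|` (J `|` E2)).
      by apply: measurableU => //; exact: measurableU.
    apply: (@le_trans _ _ (law p (E1 `|` (J `|` E2)))).
      by apply: le_measure => //; rewrite inE.
    apply: le_trans (measureU2 _ _ _) _ => //; first exact: measurableU.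
    by apply: leeD => //; exact: measureU2.
  by move: l1 l2; rewrite !ptS; lra.
have etaL : L * eta <= L * Num.sqrt (g * r) by rewrite ler_pM2l.
move: hO hJ; rewrite !discrepancy_indic// /count_in.
have NI : 0 <= N%:R^-1 :> R by rewrite invr_ge0 ltW.
have {}cIO := ler_wpM2l NI cIO; have {}cJI := ler_wpM2l NI cJI.
move: cIO cJI lIO lJI lE etaL etaS.
move: (N%:R^-1 * _) (N%:R^-1 * _) (N%:R^-1 * _) => nJ nI nO.
move: (fine (law p I)) (fine (law p J)) (fine (law p O)) (Num.sqrt _) => qI qJ qO S.
rewrite !ler_norml => ? ? ? ? ? ? ? /andP[? ?] /andP[? ?].
by apply/andP; split; lra.
Qed.

(** * Accuracy of kernel estimates *)

Lemma kde_error (R : realType) (K : R -> R) (c : R) (l m : nat) (p : density R)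
    (x : m.-tuple R) (q : {poly R}) (s g D E : R) :
  is_kernel K -> kernel_order K l -> (forall v, `|K v| <= c) ->
  `|discrepancy p x (fun y => K ((y - s) / g))| <= E ->
  0 < g -> (size q <= l.+1)%N -> q`_0 = p s ->
  (forall y, s - g <= y <= s + g -> `|p y - q.[y - s]| <= D) ->
  `|kde K x s g - p s| <= E / g + 2 * c * D.
Proof.
move=> kK oK Kc HE g0 sq q0 pq.
have HB := kernel_bias kK Kc oK g0 sq q0 pq.
set J := \int[lebesgue_measure]_y (K ((y - s) / g) * p y) in HB.
have -> : kde K x s g - p s =
    (discrepancy p x (fun y => K ((y - s) / g)) + (J - g * p s)) / g.
  rewrite /kde /discrepancy /scaled -mulr_sumr -/J.
  by move: (m%:R^-1) => mi; field; rewrite gt_eqF.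
rewrite normrM normfV (gtr0_norm g0) ler_pdivrMr//.
apply: le_trans (ler_normD _ _) _.
by rewrite mulrDl divfK ?gt_eqF// lerD.
Qed.

Lemma sup_norm_ge (R : realType) (U : set R) (f : R -> R) (x : R) :
  U x -> (`|f x|%:E <= sup_norm U f)%E.
Proof. by move=> Ux; apply: ereal_sup_ubound; exists x. Qed.

Lemma sup_norm_ge0 (R : realType) (U : set R) (f : R -> R) (x : R) :
  U x -> (0 <= sup_norm U f)%E.
Proof. by move=> Ux; apply: le_trans (sup_norm_ge f Ux); rewrite lee_fin. Qed.

(** Two distinct points of [U] make all the terms of the norm nonnegative: the supremum of an empty set of quotients is [-oo]. *)
Lemma hoelder_norm_bounds (R : realType) (m : nat) (b L : R) (U : set R) (f : R -> R)
    (u v : R) : U u -> U v -> u != v -> (hoelder_norm m b U f <= L%:E)%E ->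
  (forall x, U x -> `|f x| <= L) /\
  (forall x y, U x -> U y -> x != y ->
     `|derive1n m f x - derive1n m f y| <= L * `|x - y| `^ (b - m%:R)).
Proof.
move=> Uu Uv uv; rewrite /hoelder_norm.
set S := (\sum_(0 <= k < m.+1) _)%E; set Q := ereal_sup _ => SQ.
have Q0 : (0 <= Q)%E.
  apply: le_trans (ereal_sup_ubound (ex_intro _ u (ex_intro _ v _))); last first.
    by split; [exact: Uu|exact: Uv|exact: uv|reflexivity].
  by rewrite lee_fin divr_ge0// powR_ge0.
have S0 : (0 <= S)%E by apply: sume_ge0 => k _; exact: sup_norm_ge0 Uu.
split=> [x Ux|x y Ux Uy xy].
  rewrite -lee_fin; apply: le_trans SQ; apply: le_trans (leeDl _ Q0).
  rewrite /S big_nat_recl//; apply: (le_trans (sup_norm_ge f Ux)).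
  by rewrite leeDl// sume_ge0// => k _; exact: sup_norm_ge0 Uu.
rewrite -ler_pdivrMr; last first.
  by rewrite powR_gt0// normr_gt0 subr_eq0.
rewrite -lee_fin; apply: le_trans SQ; apply: le_trans (leeDr _ S0).
by apply: ereal_sup_ubound; exists x, y.
Qed.

Lemma strict_floor_le (R : realType) (b : R) (l : nat) :
  0 < b -> (strict_floor (Num.min b l.+1%:R) <= l)%N /\
           (strict_floor (Num.min b l.+1%:R))%:R < b.
Proof.
move=> b0; have m0 : 0 < Num.min b l.+1%:R by rewrite lt_min b0/= ltr0n.
have /andP[h _] := strict_floorP m0.
split; last by apply: lt_le_trans h _; rewrite ge_min lexx.
rewrite -ltnS -(ltr_nat R); apply: lt_le_trans h _.
by rewrite ge_min lexx orbT.
Qed.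

(** The quotients have exponent [b] minus the capped order, so the remainder has
the full rate [b] even when [b] exceeds the order of the kernel, whereas the
degree of the polynomial stays at most [l]. *)
Lemma hoelder_capped_taylor (R : realType) (l : nat) (c r b L : R) (f : R -> R) :
  0 < b -> 0 < L -> 0 < r -> hoelder_capped l.+1%:R (oball c r) b L f ->
  forall s, oball c r s -> exists q : {poly R},
    [/\ (size q <= l.+1)%N, q`_0 = f s &
      forall y, oball c r y -> `|f y - q.[y - s]| <= L * `|y - s| `^ b].
Proof.
move=> b0 L0 r0 [df hf] s Us.
set m := strict_floor _ in df hf.
have [ml mb] : (m <= l)%N /\ m%:R < b := strict_floor_le l b0.
have Uc : oball c r c by rewrite /oball/= in_itv/=; apply/andP; split; lra.
have Uc' : oball c r (c + r / 2).
  by rewrite /oball/= in_itv/=; apply/andP; split; lra.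
have cc' : c != c + r / 2 by rewrite lt_eqF//; lra.
have [_ H] := hoelder_norm_bounds Uc Uc' cc' hf.
have [|x Ux|q [sq q0 Hq]] := @taylor_hoelder R m f c r L (b - m%:R) s _ (ltW L0) df _ Us.
- by rewrite subr_gt0.
- have [->|xs] := eqVneq x s; last exact: H.
  by rewrite !subrr normr0 mulr_ge0// ?powR_ge0// ltW.
exists q; split=> [||y Uy]//; first by rewrite (leq_trans sq)// ltnS.
apply: le_trans (Hq y Uy) _; rewrite -mulrA ler_wpM2l ?(ltW L0)//.
have [->|ys] := eqVneq y s.
  rewrite !subrr normr0 powR0; last by rewrite subr_eq0 gt_eqF.
  by rewrite mul0r powR_ge0.
rewrite -powR_mulrn// -powRD; last by rewrite normr_eq0 subr_eq0 ys implybT.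
by rewrite subrK.
Qed.

Lemma hoelder_norm_subset (R : realType) (m : nat) (b : R) (U V : set R) (f : R -> R) :
  U `<=` V -> (hoelder_norm m b U f <= hoelder_norm m b V f)%E.
Proof.
move=> UV; apply: leeD.
  apply: lee_sum => k _; apply: le_ereal_sup => _ [x Ux <-].
  by exists x => //; exact: UV.
apply: le_ereal_sup => _ [x [y [Ux Uy xy ->]]].
by exists x, y; split=> //; exact: UV.
Qed.

Lemma hoelder_class_capped (R : realType) (l : nat) (b L : R) (U V : set R) (f : R -> R) :
  b <= l.+1%:R -> U `<=` V -> hoelder_class V b L f -> hoelder_capped l.+1%:R U b L f.
Proof.
move=> bl UV [df hf]; rewrite /hoelder_capped min_l//; split.
  by move=> k x km Ux; apply: df => //; exact: UV.
by apply: le_trans hf; exact: hoelder_norm_subset.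
Qed.

Lemma sqrt_powR (R : realType) (a z : R) : Num.sqrt (a `^ z) = a `^ (z * 2^-1).
Proof. by rewrite powRrM powR12_sqrt// powR_ge0. Qed.

(** As [j + 2 < i], the bandwidth is at most [2 ^- j / 8]; the window around a
point of the ball of radius [7 / 8 * 2 ^- j] thus stays in the ball where the
expansion of [p] is available. *)
Lemma kde_accuracy (R : realType) (K : R -> R) (l N : nat) (c L eps : R)
    (p : density R) (x : N.-tuple R) (b tau : R) (j : nat) (r := ln N%:R / N%:R : R) :
  is_kernel K -> kernel_order K l -> 0 < c -> (forall v, `|K v| <= c) ->
  kernel_deviation_bound K c p x -> interval_deviation_bound L eps p x ->
  0 < L -> 0 < r -> 0 < b -> 0 <= tau <= 1 -> 2 ^- j <= eps / 2 ->
  (forall s, oball tau (2 ^- j) s -> exists q : {poly R},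
    [/\ (size q <= l.+1)%N, q`_0 = p s &
      forall y, oball tau (2 ^- j) y -> `|p y - q.[y - s]| <= L * `|y - s| `^ b]) ->
  forall (i : nat) (s : R),
  (j + 2 < i)%N -> 4 * r <= 2 ^- i -> oball tau (7 / 8 * 2 ^- j) s ->
  `|kde K x s (2 ^- i) - p s|
    <= 2 * c * (11 * L + 5) * Num.sqrt (r / 2 ^- i) + 2 * c * L * (2 ^- i) `^ b.
Proof.
move=> kK oK c0 Kc Kdisc dev L0 r0 b0 tau01 jeps taylor i s ji ri.
rewrite /oball/= in_itv/= => /andP[s1 s2].
have [t0 t1] := andP tau01.
set g : R := 2 ^- i in ri *; set h : R := 2 ^- j in s1 s2 taylor jeps *.
have g0 : 0 < g by rewrite invr_gt0 exprn_gt0.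
have h0 : 0 < h by rewrite invr_gt0 exprn_gt0.
have gh : g <= h / 8.
  have -> : h / 8 = 2 ^- (j + 3).
    by rewrite exprD invfM; congr (_ * _^-1); rewrite -natrX.
  by rewrite lef_pV2 ?posrE ?exprn_gt0// ler_weXn2l//; [lra|rewrite addn3 -addn2].
have Us : oball tau h s by rewrite /oball/= in_itv/=; apply/andP; split; lra.
have [q [sq q0 Hq]] := taylor _ Us.
have DI I : is_interval I -> I `<=` `[s - g, s + g] ->
    `|discrepancy p x \1_I| <= (11 * L + 5) * Num.sqrt (g * r).
  by move=> iI Is; apply: (dev i s I ri) => //; rewrite -/g; lra.
have HD y : s - g <= y <= s + g -> `|p y - q.[y - s]| <= L * g `^ b.
  move=> /andP[y1 y2]; apply: (le_trans (Hq y _)).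
    by rewrite /oball/= in_itv/=; apply/andP; split; lra.
  rewrite ler_pM2l// ge0_ler_powR ?nnegrE ?(ltW b0) ?(ltW g0)//.
  by rewrite ler_norml; apply/andP; split; lra.
apply: le_trans (kde_error kK oK Kc (Kdisc s g _ g0 DI) g0 sq q0 HD) _.
rewrite [2 * c * (L * _)]mulrA lerD2r.
have -> : 2 * c * ((11 * L + 5) * Num.sqrt (g * r)) / g =
    2 * c * (11 * L + 5) * (Num.sqrt (g * r) / g) by rewrite !mulrA.
have L11 : 0 < 11 * L + 5 by lra.
rewrite ler_pM2l; last by rewrite !mulr_gt0.
have gE : g = Num.sqrt (g * g) by rewrite -expr2 sqrtr_sqr ger0_norm// ltW.
have rg0 : 0 <= r / g by apply: divr_ge0; exact: ltW.
rewrite ler_pdivrMr// [X in _ <= _ * X]gE -(sqrtrM _ rg0).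
rewrite le_eqVlt; apply/orP; left; apply/eqP; congr Num.sqrt; field.
by rewrite gt_eqF.
Qed.

(** Under the bound on [2 ^- j], the bias at scale [2 ^- j] is at most the power
[b / (2 * b + 1)] of [r], which is below the noise level of every bandwidth
smaller than [2 ^- j]. *)
Lemma kde_difference (R : realType) (K : R -> R) (l N : nat) (c L eps : R)
    (p : density R) (x : N.-tuple R) (b tau : R) (j : nat) (r := ln N%:R / N%:R : R) :
  is_kernel K -> kernel_order K l -> 0 < c -> (forall v, `|K v| <= c) ->
  kernel_deviation_bound K c p x -> interval_deviation_bound L eps p x ->
  0 < L -> 0 < r -> 0 < b -> 0 <= tau <= 1 -> 2 ^- j <= eps / 2 ->
  (forall s, oball tau (2 ^- j) s -> exists q : {poly R},
    [/\ (size q <= l.+1)%N, q`_0 = p s &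
      forall y, oball tau (2 ^- j) y -> `|p y - q.[y - s]| <= L * `|y - s| `^ b]) ->
  forall (m m' : nat) (s : R), r < 1 ->
  2 ^- j <= r `^ (2 * b + 1)^-1 ->
  (j + 2 < m')%N -> (m' < m)%N -> 4 * r <= 2 ^- m ->
  oball tau (7 / 8 * 2 ^- j) s ->
  `|kde K x s (2 ^- m) - kde K x s (2 ^- m')|
    <= (4 * c * (11 * L + 5) + 4 * c * L) * Num.sqrt (ln N%:R / (N%:R * 2 ^- m)).
Proof.
move=> kK oK c0 Kc Kdisc dev L0 r0 b0 tau01 jeps taylor 
  m m' s r1 jr jm' mm rm Us.
have mm' : 2 ^- m <= 2 ^- m' :> R.
  rewrite lef_pV2 ?posrE ?exprn_gt0// ler_weXn2l//; first by lra.
  exact: ltnW.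
have acc := kde_accuracy kK oK c0 Kc Kdisc dev L0 r0 b0 tau01 jeps taylor.
have H1 := acc _ _ (ltn_trans jm' mm) rm Us.
have H2 := acc _ _ jm' (le_trans rm mm') Us.
set g : R := 2 ^- m in rm mm' H1 *; set g' : R := 2 ^- m' in mm' H2 *.
have g0 : 0 < g by rewrite invr_gt0 exprn_gt0.
have g0' : 0 < g' by rewrite invr_gt0 exprn_gt0.
have -> : ln N%:R / (N%:R * g) = r / g by rewrite /r invfM mulrA.
set S := Num.sqrt (r / g).
have S' : Num.sqrt (r / g') <= S.
  by rewrite ler_wsqrtr// ler_pM2l// lef_pV2// posrE.
have gg' : g `^ b <= g' `^ b by rewrite ge0_ler_powR ?nnegrE ?(ltW b0) ?(ltW g0) ?(ltW g0').
have g'S : g' `^ b <= S.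
  have b21 : 0 < 2 * b + 1 by have := b0; lra.
  have half_exponent : (2 * b + 1)^-1 * b = (1 - (2 * b + 1)^-1) * 2^-1.
    by move: b21; clear => b21; field; rewrite gt_eqF.
  have g'j : g' <= 2 ^- j.
    rewrite lef_pV2 ?posrE ?exprn_gt0// ler_weXn2l//; first by lra.
    by apply: ltnW; apply: leq_ltn_trans jm'; exact: leq_addr.
  have g'r : g' <= r `^ (2 * b + 1)^-1 by apply: le_trans jr.
  apply: (@le_trans _ _ ((r `^ (2 * b + 1)^-1) `^ b)).
    by rewrite ge0_ler_powR ?nnegrE ?(ltW b0) ?(ltW g0') ?powR_ge0.
  have rho0 : 0 < r `^ (2 * b + 1)^-1 by rewrite powR_gt0.
  have -> : (r `^ (2 * b + 1)^-1) `^ b = Num.sqrt (r / r `^ (2 * b + 1)^-1).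
    have -> : r / r `^ (2 * b + 1)^-1 = r `^ (1 - (2 * b + 1)^-1).
      by rewrite powRD ?(gt_eqF r0) ?implybT// powRN powRr1// ltW.
    by rewrite sqrt_powR -powRrM half_exponent.
  rewrite ler_wsqrtr// ler_pM2l// lef_pV2 ?posrE//.
  exact: le_trans mm' _.
have L11 : 0 < 11 * L + 5 by lra.
have A0 : 0 < 2 * c * (11 * L + 5) by rewrite !mulr_gt0.
have B0 : 0 < 2 * c * L by rewrite !mulr_gt0.
have e1 : 2 * c * (11 * L + 5) * Num.sqrt (r / g') <= 2 * c * (11 * L + 5) * S.
  by rewrite ler_pM2l.
have e2 : 2 * c * L * g' `^ b <= 2 * c * L * S by rewrite ler_pM2l.
have e3 : 2 * c * L * g `^ b <= 2 * c * L * S.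
  by rewrite ler_pM2l// (le_trans gg').
have -> : (4 * c * (11 * L + 5) + 4 * c * L) * S =
   2 * (2 * c * (11 * L + 5) * S) + 2 * (2 * c * L * S) by ring.
rewrite -/S in H1; move: H1 H2; rewrite !ler_norml.
move: e1 e2 e3; set a1 := 2 * c * (11 * L + 5) * Num.sqrt (r / g').
move: (2 * c * (11 * L + 5) * S) (2 * c * L * S) (2 * c * L * g `^ b)
  (2 * c * L * g' `^ b) => ? ? ? ? ? ? ?.
by move=> /andP[? ?] /andP[? ?]; apply/andP; split; lra.
Qed.

(** * The selected bandwidth *)

Lemma least_le (A : set nat) (j : nat) : A j -> (least A <= j)%N.
Proof.
move=> Aj; have exA : exists n, `[< A n >] by exists j; apply/asboolP.
have [m /asboolP Am mmin] := ex_minnP exA.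
have : [set j | A j /\ forall k, A k -> (j <= k)%N] (least A).
  by apply: xgetPex; exists m; split=> // k Ak; apply: mmin; apply/asboolP.
by move=> [_]; exact.
Qed.

Lemma cell_indexP (R : realType) (bmin eps k1 : R) (n : nat) (t : R) :
  (0 < delta_inv bmin eps k1 n)%N -> 0 <= t <= 1 ->
  let k := cell_index bmin eps k1 n t in
  let d := delta bmin eps k1 n in
  forall i, i = k \/ i = k.-1 -> 0 <= i%:R * d <= 1 /\ `|i%:R * d - t| <= d.
Proof.
set D := delta_inv bmin eps k1 n => D0 /andP[t0 t1] k d.
have D0' : 0 < D%:R :> R by rewrite ltr0n.
have d0 : 0 < d by rewrite invr_gt0.
have Dd : D%:R * d = 1 by rewrite /d /delta -/D divff// gt_eqF.
have [/andP[k0 kD] kt] : (1 <= k <= D)%N /\ cell bmin eps k1 n k t.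
  apply: (@xgetPex _ 0%N [set k | (1 <= k <= D)%N /\ cell bmin eps k1 n k t]).
  have [tD|Dt] := leP (1 - d) t.
    exists D; split; first by rewrite D0 leqnn.
    by rewrite /cell -/D ltnn /= in_itv/= tD.
  have td0 : 0 <= t / d by rewrite divr_ge0// ltW.
  have /andP[h1 h2] := truncn_itv td0.
  move: h1 h2; rewrite ler_pdivlMr// ltr_pdivrMr//.
  set i := Num.truncn (t / d) => h1 h2.
  have iD : (i.+1 < D)%N.
    rewrite -(ltr_nat R) -(ltr_pM2r d0) Dd -natr1 mulrDl mul1r.
    have : i%:R * d + d <= t + d by rewrite lerD2r.
    by lra.
  exists i.+1; split; first by rewrite ltn0Sn/= ltnW.
  by rewrite /cell iD /= in_itv/= h1.
have kE : k%:R = k.-1%:R + 1 :> R by rewrite natr1 prednK.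
have kd : k%:R * d = k.-1%:R * d + d by rewrite kE mulrDl mul1r.
have tk : k.-1%:R * d <= t <= k%:R * d.
  move: kt; rewrite /cell -/D; case: ifPn => [_|].
    by rewrite /= in_itv/= => /andP[h1 h2]; rewrite -/d in h1 h2; rewrite h1 ltW.
  rewrite -leqNgt => Dk; have kDE : k = D by apply/eqP; rewrite eqn_leq kD.
  rewrite /= in_itv/= -/(delta bmin eps k1 n) -/d => /andP[h1 h2].
  by rewrite kDE Dd h2 andbT; move: kd; rewrite kDE Dd; lra.
have kd1 : k%:R * d <= 1 by rewrite -[leRHS]Dd ler_pM2r// ler_nat.
have kd0 : 0 <= k.-1%:R * d by rewrite mulr_ge0// ltW.
have {}tk := andP tk; case: tk => tk1 tk2 i [->|->]; split.
- by apply/andP; split=> //; lra.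
- by rewrite ler_norml; apply/andP; split; lra.
- by apply/andP; split=> //; lra.
- by rewrite ler_norml; apply/andP; split; lra.
Qed.

Lemma ln_gt0_natr_gt0 (R : realType) (N : nat) :
  0 < ln N%:R :> R -> 0 < N%:R :> R.
Proof.
by move=> l0; rewrite ltNge; apply/negP => /ln0 h; rewrite h ltxx in l0.
Qed.

Lemma ln2_gt0 (R : realType) : 0 < ln 2 :> R.
Proof. by rewrite ln_gt0//; lra. Qed.

Lemma le_log2 (R : realType) (j : nat) (y : R) : 0 < y ->
  (j%:R <= log2 y) = (2 ^+ j <= y).
Proof.
move=> y0; rewrite /log2 ler_pdivlMr ?ln2_gt0// mulr_natl.
by rewrite -lnXn// ler_ln ?posrE ?exprn_gt0.
Qed.

Lemma jmin_ge (R : realType) (eps : R) : 0 < eps ->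
  (2 <= jmin eps)%N /\ 2 ^- jmin eps <= eps / 2.
Proof.
move=> e0; set a := Num.max 2 (log2 (2 / eps)).
have ja : a <= (jmin eps)%:R.
  rewrite natr_absz (le_trans (ceil_ge a))//.
  by rewrite ler_int ler_norm.
split.
  by rewrite -(ler_nat R) (le_trans _ ja)// le_max lexx.
have : log2 (2 / eps) <= (jmin eps)%:R by rewrite (le_trans _ ja)// le_max lexx orbT.
rewrite /log2 ler_pdivrMr ?ln2_gt0// [_ * ln 2]mulr_natl -lnXn//.
rewrite ler_ln ?posrE ?exprn_gt0 ?divr_gt0// => h.
by rewrite -[leRHS]invrK invf_div lef_pV2 ?posrE ?exprn_gt0 ?divr_gt0.
Qed.

Lemma exponentsP (R : realType) (eps k2 : R) (n j : nat) :
  0 < ln (n./2)%:R :> R ->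
  exponents eps k2 n j <->
    (jmin eps <= j)%N /\ 2 ^+ j <= (n./2)%:R / ln (n./2)%:R `^ k2.
Proof.
move=> l0; rewrite /exponents/= /jmax.
have N0 : 0 < (n./2)%:R :> R by exact: ln_gt0_natr_gt0.
rewrite floor_ge_int -le_log2//.
by rewrite divr_gt0// powR_gt0.
Qed.

Lemma exponents_rate (R : realType) (eps k2 : R) (n j : nat) :
  4 <= k2 -> 2 <= ln (n./2)%:R :> R -> exponents eps k2 n j ->
  4 * (ln (n./2)%:R / (n./2)%:R) <= 2 ^- j :> R.
Proof.
move=> k4 l2; have l0 : 0 < ln (n./2)%:R :> R by lra.
move=> /(exponentsP _ _ _ l0)[_].
have N0 : 0 < (n./2)%:R :> R by exact: ln_gt0_natr_gt0.
move: l2 l0 N0; set l := ln _; move: (n./2)%:R => N l2 l0 N0.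
have lk0 : 0 < l `^ k2 by rewrite powR_gt0.
have lk : 4 * l <= l `^ k2.
  apply: (@le_trans _ _ (l `^ 4%:R)); last by rewrite ler_powR//; lra.
  rewrite powR_mulrn ?(ltW l0)// (exprD _ 2 2) !expr2.
  have l4 : 4 <= l * l by apply: (@le_trans _ _ (2 * 2)); [lra|apply: ler_pM; lra].
  apply: (@le_trans _ _ (4 * (l * l))); last by rewrite ler_pM2r// mulr_gt0.
  by rewrite ler_pM2l// ler_peMl ?(ltW l0)//; lra.
move=> h; have {h} : l `^ k2 / N <= 2 ^- j.
  by rewrite -[leLHS]invrK invf_div lef_pV2 ?posrE ?exprn_gt0 ?divr_gt0.
by apply: le_trans; rewrite mulrA ler_pM2r// invr_gt0.
Qed.

Lemma dyadic_between (R : realType) (h : R) : 0 < h <= 1 ->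
  exists j : nat, h / 4 <= 2 ^- j <= h / 2.
Proof.
move=> /andP[h0 h1].
have exj : exists j, (2 ^- j <= h / 2).
  exists (Num.truncn (2 / h)).+1.
  rewrite -[leRHS]invrK invf_div lef_pV2 ?posrE ?exprn_gt0 ?divr_gt0//.
  apply: (@le_trans _ _ (Num.truncn (2 / h)).+1%:R); first exact/ltW/truncnS_gt.
  by rewrite -natrX ler_nat ltnW// ltn_expl.
have [[|j] hj jmin'] := ex_minnP exj; first by move: hj; rewrite expr0 invr1; lra.
exists j.+1; rewrite hj andbT.
have : h / 2 <= 2 ^- j.
  by rewrite leNgt; apply/negP => /ltW/jmin'; rewrite ltnn.
by rewrite exprS invfM; lra.
Qed.

Lemma delta_inv_bounds (R : realType) (bmin eps k1 : R) (n : nat)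
    (l := ln (n./2)%:R : R) (r := l / (n./2)%:R) :
    0 < bmin < 1 -> 0 < eps -> (2 * bmin)^-1 <= k1 ->
    2 <= l -> r <= 1 ->
  let X := 2 `^ ((jmin eps)%:R / bmin) * r `^ (- k1) * l `^ (2 / bmin) in
  8 <= X /\ X <= (delta_inv bmin eps k1 n)%:R <= 2 * X.
Proof.
move=> /andP[b0 b1] e0 hk1 l2 r1 X.
have l0 : 0 < l by lra.
have N0 : 0 < (n./2)%:R :> R by exact: ln_gt0_natr_gt0.
have r0 : 0 < r by rewrite divr_gt0.
have bV : 1 <= bmin^-1 by rewrite invf_ge1// ltW.
have k10 : 0 <= k1 by apply: le_trans hk1; rewrite invr_ge0; lra.
have h1 : 4 <= 2 `^ ((jmin eps)%:R / bmin).
  apply: (@le_trans _ _ (2 `^ 2%:R)).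
    by rewrite powR_mulrn// expr2; lra.
  apply: ler_powR; first by lra.
  rewrite -[leLHS]mulr1 ler_pM//.
  by rewrite ler_nat; have [] := jmin_ge e0.
have h2 : 1 <= r `^ (- k1).
  rewrite powRN -[leLHS]invr1 lef_pV2 ?posrE ?powR_gt0//.
  by rewrite -[leRHS](powRr0 r) ger_powR// r0.
have h3 : 2 <= l `^ (2 / bmin).
  have l1 : 1 <= l by lra.
  apply: le_trans l2 _; apply: (le1r_powR l1).
  apply: le_trans bV _; rewrite ler_peMl ?invr_ge0 ?(ltW b0)//; lra.
have X8 : 8 <= X.
  apply: (@le_trans _ _ (4 * 1 * 2)); first by lra.
  by rewrite /X !ler_pM//.
split=> //; rewrite /delta_inv -/l -/r -/X.
have c0 : 0 <= Num.ceil X by rewrite -(ler_int R) (le_trans _ (ceil_ge X))//; lra.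
rewrite natr_absz ger0_norm// ceil_ge/=.
by have /andP[] := ceil_itv X; rewrite intrB; lra.
Qed.

(** The three factors of the inverse mesh dominate those of twice the inverse
radius one by one; for the powers of [r] this is
[(2 * b + 1)^-1 <= (2 * bmin)^-1 <= k1]. *)
Lemma delta_le_radius (R : realType) (bmin eps k1 : R) (n : nat)
    (l := ln (n./2)%:R : R) (r := l / (n./2)%:R) (b : R) :
  0 < bmin < 1 -> 0 < eps -> (2 * bmin)^-1 <= k1 ->
  2 <= l -> r <= 1 -> bmin <= b ->
  delta bmin eps k1 n <= local_radius eps n b / 2.
Proof.
move=> b01 e0 hk1 l2 r1 hb; have [b0 b1] := andP b01.
have e2 : (2 * b + 1)^-1 <= (2 * bmin)^-1.
  have b02 : 0 < 2 * bmin by lra.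
  have bb : 2 * bmin <= 2 * b + 1 by lra.
  by rewrite lef_pV2// posrE (lt_le_trans b02).
have b21 : 0 < 2 * b + 1 by lra.
have l0 : 0 < l by lra.
have l1 : 1 <= l by lra.
have [X8 /andP[XD _]] := delta_inv_bounds b01 e0 hk1 l2 r1.
set X := _ * _ * _ in X8 XD.
have X0 : 0 < X by apply: lt_le_trans X8.
have N0 : 0 < (n./2)%:R :> R by exact: ln_gt0_natr_gt0.
have r0 : 0 < r by rewrite divr_gt0.
have bV : 1 <= bmin^-1 by rewrite invf_ge1// ltW.
apply: (@le_trans _ _ X^-1).
  by rewrite /delta lef_pV2// posrE (lt_le_trans X0).
rewrite /local_radius -/l -/r.
have h1 : 2 ^+ jmin eps <= 2 `^ ((jmin eps)%:R / bmin).
  rewrite -powR_mulrn//; apply: ler_powR; first by rewrite ler1n.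
  by rewrite ler_peMr.
have h2 : (r `^ (2 * b + 1)^-1)^-1 <= r `^ (- k1).
  rewrite -powRN; apply: ger_powR; first by rewrite r0.
  by rewrite lerN2 (le_trans _ hk1).
have h3 : 2 <= l `^ (2 / bmin).
  apply: le_trans l2 _; apply: (le1r_powR l1).
  by apply: le_trans bV _; rewrite ler_peMl ?invr_ge0 ?(ltW b0)// ler1n.
rewrite [leRHS](_ : _ =
    (2 ^+ jmin eps * (r `^ (2 * b + 1)^-1)^-1 * 2)^-1); last first.
  by rewrite !invfM !invrK.
have p0 : 0 < (r `^ (2 * b + 1)^-1)^-1 by rewrite invr_gt0 powR_gt0.
rewrite lef_pV2 ?posrE//; last by rewrite !mulr_gt0// exprn_gt0.
rewrite /X; apply: ler_pM => //.
  by rewrite mulr_ge0 ?exprn_ge0// ltW.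
by apply: ler_pM => //; rewrite ?exprn_ge0 ?(ltW p0).
Qed.

(** An exponent [j] with [2 ^- j] between a quarter and a half of the radius passes
the selection test at both ends of the cell of [t], because the balls of radius
[2 ^- j] around these ends stay in the ball around [t] where [p] is smooth. The
selected exponents are therefore at most [j], and undersmoothing costs the power
of [ln N]. *)
Lemma bandwidth_lower_bound (R : realType) (K : R -> R) (l : nat)
    (c L eps bmin k1 k2 c1 c2 : R) (n : nat) (p : density R)
    (x2 : (n./2).-tuple R) (t b : R)
    (ln_N := ln (n./2)%:R : R) (r := ln_N / (n./2)%:R) :
  is_kernel K -> kernel_order K l -> 0 < c -> (forall v, `|K v| <= c) ->
  kernel_deviation_bound K c p x2 -> interval_deviation_bound L eps p x2 ->
  0 < L -> 0 < eps < 1 -> 0 < bmin < 1 -> (2 * bmin)^-1 <= k1 -> 4 <= k2 ->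
  4 * c * (11 * L + 5) + 4 * c * L <= c2 ->
  2 <= ln_N -> r < 1 ->
  4 * 2 ^+ jmin eps * r `^ (- (2 * bmin + 1)^-1) <= (n./2)%:R / ln_N `^ k2 ->
  0 <= t <= 1 -> bmin <= b ->
  hoelder_capped l.+1%:R (oball t (local_radius eps n b)) b L p ->
  local_radius eps n b / 4 * ln_N `^ (- (c1 * ln 2))
    <= hloc K bmin eps k1 k2 c1 c2 x2 t.
Proof.
move=> kK oK c0 Kc Kdisc dev L0 eps01 b01 hk1 k4 hc2 l2 r1 r_large t01 hb hp.
have [e0 e1] := andP eps01; have [bmin0 bmin1] := andP b01.
have b0 : 0 < b by apply: lt_le_trans hb.
have b21 : 0 < 2 * b + 1 by move: b0; clear; lra.
have bm21 : 0 < 2 * bmin + 1 by move: bmin0; clear; lra.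
have eb : (2 * b + 1)^-1 <= (2 * bmin + 1)^-1.
  have le_b : 2 * bmin + 1 <= 2 * b + 1 by move: hb; clear; lra.
  by rewrite lef_pV2.
have l0 : 0 < ln_N by apply: lt_le_trans l2.
have N0 : 0 < (n./2)%:R :> R by exact: ln_gt0_natr_gt0.
have r0 : 0 < r by rewrite divr_gt0.
have [jm2 jmeps] := jmin_ge e0.
have dl := delta_le_radius b01 e0 hk1 l2 (ltW r1) hb.
have hE : local_radius eps n b = 2 ^- jmin eps * r `^ (2 * b + 1)^-1 by [].
set h := local_radius eps n b in hp dl hE *.
set rho := r `^ (2 * b + 1)^-1 in hE.
have rho0 : 0 < rho by rewrite powR_gt0.
have rho1 : rho <= 1.
  by rewrite -[leRHS](powRr0 r) ger_powR ?r0 ?(ltW r1)// invr_ge0 ltW.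
have jrE : rho = r `^ (2 * b + 1)^-1 by [].
clearbody h rho.
have pj0 : 0 < 2 ^- jmin eps :> R by rewrite invr_gt0 exprn_gt0.
have pj1 : 2 ^- jmin eps <= 1 :> R by move: jmeps e1; move: (2 ^- jmin eps) => pj; clear; lra.
have h0 : 0 < h by rewrite hE mulr_gt0.
have hpj : h <= 2 ^- jmin eps by rewrite hE ler_piMr// ltW.
have hrho : h <= rho by rewrite hE ler_piMl// ltW.
have h1 : h <= 1 by exact: le_trans hrho rho1.
have [j /andP[jl ju]] : exists j : nat, h / 4 <= 2 ^- j <= h / 2.
  by apply: dyadic_between; rewrite h0.
have expj : exponents eps k2 n j.
  apply/exponentsP => //; split.
    have : 2 ^- j <= 2 ^- jmin eps :> R.
      by move: h0 ju hpj; move: (2 ^- jmin eps) => pj; clear; lra.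
    by rewrite lef_pV2 ?posrE ?exprn_gt0// ler_eXn2l// ltr1n.
  apply: le_trans r_large.
  apply: (@le_trans _ _ (4 * 2 ^+ jmin eps * rho^-1)).
    have -> : 4 * 2 ^+ jmin eps * rho^-1 = (h / 4)^-1.
      rewrite hE; move: (2 ^+ jmin eps) => z.
      by rewrite !invfM !invrK; ring.
    by rewrite -[leLHS]invrK lef_pV2 ?posrE ?invr_gt0 ?exprn_gt0 ?divr_gt0.
  rewrite jrE ler_pM2l ?mulr_gt0 ?exprn_gt0// -powRN.
  by rewrite ger_powR ?r0 ?(ltW r1)// lerN2.
have T := hoelder_capped_taylor b0 L0 h0 hp.
have jhat_j tau : 0 <= tau <= 1 -> `|tau - t| <= delta bmin eps k1 n ->
    (jhat K bmin eps k1 k2 c2 x2 tau <= j)%N.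
  move=> tau01; rewrite ler_norml => /andP[tl tu].
  have sub y : oball tau (2 ^- j) y -> oball t h y.
    rewrite /oball/= !in_itv/= => /andP[y1 y2].
    move: dl tl tu y1 y2 ju.
    move: (delta _ _ _ _) => d; clear => *; apply/andP; split; lra.
  apply: least_le; split=> // m m' expm expm' mm jm' s Us _.
  have rm := exponents_rate k4 l2 expm.
  have jeps : 2 ^- j <= eps / 2.
    by move: h0 ju hpj jmeps; move: (2 ^- jmin eps) => pj; clear; lra.
  have jr : 2 ^- j <= r `^ (2 * b + 1)^-1 by rewrite -jrE; move: h0 ju hrho; clear; lra.
  have T' s' : oball tau (2 ^- j) s' -> exists q : {poly R},
    [/\ (size q <= l.+1)%N, q`_0 = p s' &
      forall y, oball tau (2 ^- j) y -> `|p y - q.[y - s']| <= L * `|y - s'| `^ b].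
    move=> /sub/T[q [sq q0 Hq]]; exists q; split=> // y /sub; exact: Hq.
  apply: le_trans (kde_difference kK oK c0 Kc Kdisc dev L0 r0 b0 tau01 jeps T'
    r1 jr jm' mm rm Us) _.
  by rewrite ler_wpM2r// sqrtr_ge0.
have D0 : (0 < delta_inv bmin eps k1 n)%N.
  have [X8 /andP[XD _]] := delta_inv_bounds b01 e0 hk1 l2 (ltW r1).
  by rewrite -(ltr_nat R) (lt_le_trans _ XD)// (lt_le_trans _ X8).
have cellP := cell_indexP D0 t01.
have u_pow : 2 `^ (- undersmoothing c1 n) = ln_N `^ (- (c1 * ln 2)).
  rewrite /undersmoothing -/ln_N /powR (gt_eqF l0) gt_eqF//.
  by congr expR; rewrite -/ln_N; ring.
have bw tau : 0 <= tau <= 1 -> `|tau - t| <= delta bmin eps k1 n ->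
    h / 4 * ln_N `^ (- (c1 * ln 2)) <=
    2 `^ (- (jhat K bmin eps k1 k2 c2 x2 tau)%:R - undersmoothing c1 n).
  move=> tau01 tt; have jj := jhat_j _ tau01 tt.
  apply: (@le_trans _ _ (2 ^- j * ln_N `^ (- (c1 * ln 2)))).
    by rewrite ler_wpM2r// powR_ge0.
  rewrite -u_pow -powR_mulrn// -powRN -powRD; last by rewrite pnatr_eq0 implybT.
  apply: ler_powR; first by rewrite ler1n.
  by rewrite lerD2r lerN2 ler_nat.
rewrite /hloc /cell_bandwidth le_min; apply/andP; split.
  by have [] := cellP _ (or_intror erefl); exact: bw.
by have [] := cellP _ (or_introl erefl); exact: bw.
Qed.

(** * Width of the band *)

Lemma ln_le_id (R : realType) (x : R) : 0 < x -> ln x <= x.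
Proof.
move=> x0; have : ln (1 + (x - 1)) <= x - 1 by apply: le_ln1Dx; lra.
by rewrite addrC subrK; lra.
Qed.

Lemma ln8_ge1 (R : realType) : 1 <= ln 8 :> R.
Proof.
have h : ln (1 + - (1 / 2)) <= - (1 / 2) :> R by apply: le_ln1Dx; lra.
have e2 : 1 + - (1 / 2) = 2^-1 :> R by field.
move: h; rewrite e2 lnV ?posrE// => {e2}h.
have -> : 8 = 2 ^+ 3 :> R by rewrite -natrX.
rewrite lnXn// -[_ *+ 3]mulr_natl; move: h.
by move: (ln 2) => x h; lra.
Qed.

(** Since [- ln delta] lies between 1 and a multiple of [ln N], the centring
sequence is O(sqrt (ln N)), while the quantile is divided by a sequence that is
bounded away from 0. *)
Lemma critical_value_le (R : realType) (K : R -> R) (L eps bmin k1 alpha : R) :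
  0 < bmin < 1 -> 0 < eps -> (2 * bmin)^-1 <= k1 ->
  exists C : R, 0 < C /\ forall n : nat,
    2 <= ln (n./2)%:R :> R -> ln (n./2)%:R / (n./2)%:R <= 1 :> R ->
    critical_value K bmin L eps k1 n alpha <= C * Num.sqrt (ln (n./2)%:R).
Proof.
move=> b01 e0 hk1; have [b0 b1] := andP b01.
have k10 : 0 <= k1 by apply: le_trans hk1; rewrite invr_ge0 mulr_ge0// ltW.
pose j : R := (jmin eps)%:R.
pose C' := ln 2 + j / bmin * ln 2 + k1 + 2 / bmin : R.
pose tv := c3 K; pose A1 := `|Num.sqrt L * gumbel_quantile (1 - alpha / 2)| * tv^-1.
have tv0 : 0 <= tv.
  rewrite /tv /c3 divr_ge0// ?sqrtr_ge0// fine_ge0//.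
  apply: ereal_sup_ubound; exists (0, 0) => //=.
  by rewrite total_variationxx.
have tvV : 0 <= tv^-1 by rewrite invr_ge0.
pose A2 := 3 * tv^-1 * Num.sqrt (2 * C').
have A1_0 : 0 <= A1 by rewrite mulr_ge0.
have A2_0 : 0 <= A2 by rewrite !mulr_ge0// sqrtr_ge0.
exists (A1 + A2 + 1); split; first by move: A1_0 A2_0; clear; lra.
move=> n; set l := ln _ => l2 r1.
have [X8 /andP[XD DX]] := delta_inv_bounds b01 e0 hk1 l2 r1.
have l0 : 0 < l by apply: lt_le_trans l2.
have l1 : 1 <= l by apply: le_trans l2; rewrite ler1n.
have N0 : 0 < (n./2)%:R :> R by exact: ln_gt0_natr_gt0.
set D := (delta_inv bmin eps k1 n)%:R in XD DX.
set X := _ * _ * _ in X8 XD DX.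
have D8 : 8 <= D by exact: le_trans XD.
have D0 : 0 < D by exact: lt_le_trans D8.
have lnD1 : 1 <= ln D by apply: le_trans (ln8_ge1 R) _; rewrite ler_ln ?posrE.
have lnDC : ln D <= C' * l.
  have r0 : 0 < l / (n./2)%:R by rewrite divr_gt0.
  apply: (@le_trans _ _ (ln (2 * X))).
    by rewrite ler_ln ?posrE// mulr_gt0// (lt_le_trans _ X8).
  rewrite /X !lnM ?posrE ?mulr_gt0 ?powR_gt0 ?invr_gt0// !ln_powR.
  rewrite [ln (l / _)]lnM ?posrE ?invr_gt0// lnV ?posrE// -/l -/j.
  have ll : ln l <= l by exact: ln_le_id.
  have ll0 : 0 <= ln l by exact: ln_ge0.
  have t1 : ln 2 <= ln 2 * l by rewrite ler_peMr// ltW// ln2_gt0.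
  have t2 : j / bmin * ln 2 <= j / bmin * ln 2 * l.
    by rewrite ler_peMr// !mulr_ge0 ?invr_ge0// ltW// ln2_gt0.
  have t3 : - k1 * (ln l - l) <= k1 * l.
    by rewrite mulNr -mulrN opprB ler_wpM2l// gerBl.
  have t4 : 2 / bmin * ln l <= 2 / bmin * l by rewrite ler_wpM2l// divr_ge0// ltW.
  have -> : C' * l = ln 2 * l + j / bmin * ln 2 * l + k1 * l + 2 / bmin * l.
    by rewrite /C' 3!mulrDl.
  move: t1 t2 t3 t4.
  move: (j / bmin * ln 2) (2 / bmin * ln l) (2 / bmin * l) => x1 x2 x3.
  move: (ln 2) (- k1 * _) => x4 x5.
  by clear => t1 t2 t3 t4; lra.
have lndelta : - ln (delta bmin eps k1 n) = ln D.
  by rewrite /delta -/D lnV ?posrE// opprK.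
have lndelta2 : - 2 * ln (delta bmin eps k1 n) = 2 * ln D.
  by rewrite -lndelta; ring.
rewrite /critical_value /a_seq /b_seq lndelta lndelta2 -/tv.
set s := Num.sqrt (2 * ln D).
have s1 : 1 <= s.
  rewrite -[leLHS]sqrtr1 ler_wsqrtr//; apply: (le_trans lnD1).
  by rewrite ler_peMl ?ler1n// (le_trans _ lnD1).
have s0 : 0 < s by apply: lt_le_trans s1.
have sC : s <= Num.sqrt (2 * C') * Num.sqrt l.
  rewrite -sqrtrM; last first.
    rewrite mulr_ge0// /C' !addr_ge0 ?mulr_ge0 ?invr_ge0 ?(ltW b0)//; by rewrite ltW// ln2_gt0.
  by rewrite ler_wsqrtr// -mulrA ler_pM2l.
have sl1 : 1 <= Num.sqrt l by rewrite -[leLHS]sqrtr1 ler_wsqrtr.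
have B1 : Num.sqrt L * gumbel_quantile (1 - alpha / 2) / (tv * s) <= A1.
  rewrite invfM mulrA /A1.
  apply: (@le_trans _ _ (`|Num.sqrt L * gumbel_quantile (1 - alpha / 2)| / tv / s)).
    by rewrite ler_wpM2r ?invr_ge0 ?(ltW s0)// ler_wpM2r// ler_norm.
  by rewrite ler_pdivrMr// ler_peMr.
have B2 : 3 / tv * (s - (ln (ln D) + ln (4 * pi)) / (2 * s)) <= A2 * Num.sqrt l.
  apply: (@le_trans _ _ (3 / tv * s)).
    rewrite ler_wpM2l ?mulr_ge0// gerBl divr_ge0//; last by rewrite mulr_ge0// ltW.
    by rewrite addr_ge0// ln_ge0//; have := pi_ge2 R; lra.
  by rewrite /A2 -[leRHS]mulrA ler_wpM2l// mulr_ge0.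
have B3 : A1 <= A1 * Num.sqrt l by rewrite ler_peMr.
rewrite [leRHS]mulrDl [(A1 + A2) * _]mulrDl mul1r.
apply: (@le_trans _ _ (A1 * Num.sqrt l + A2 * Num.sqrt l)).
  by apply: lerD => //; exact: (le_trans B1 B3).
by rewrite lerDl (le_trans _ sl1).
Qed.

Lemma band_width_le (R : realType) (K : R -> R) (bmin L eps k1 k2 c1 c2 alpha C : R)
    (n : nat) (x1 x2 : (n./2).-tuple R) (t : R) :
  0 <= C ->
  critical_value K bmin L eps k1 n alpha <= C ->
  (lebesgue_measure (confidence_band K bmin L eps k1 k2 c1 c2 alpha x1 x2 t)
   <= (2 * C / Num.sqrt ((n./2)%:R * hloc K bmin eps k1 k2 c1 c2 x2 t))%:E)%E.
Proof.
move=> C0 qC; rewrite /confidence_band lebesgue_measure_itv/= lte_fin.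
set q := critical_value _ _ _ _ _ _ _ in qC *.
set S := Num.sqrt _; set y := ploc _ _ _ _ _ _ _.
have SV : 0 <= S^-1 by rewrite invr_ge0 sqrtr_ge0.
have qS : q / S <= C / S by rewrite ler_wpM2r.
case: ifP => _; last by rewrite lee_fin !mulr_ge0.
rewrite -EFinD lee_fin -mulrA; move: qS; move: (q / S) (C / S) => u v.
by clear => uv; lra.
Qed.

(** With [N = l / r] the powers of [r] cancel exactly: [N] times the power
[1 / (2 * b + 1)] of [r] is [l] times the square of the power
[- b / (2 * b + 1)]. *)
Lemma width_rate_le (R : realType) (N l r H C a pj b : R) :
  0 < N -> 0 < l -> r = l / N -> 0 < pj -> 0 < b -> 0 <= C ->
  pj * r `^ (2 * b + 1)^-1 / 4 * l `^ (- a) <= H ->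
  2 * (C * Num.sqrt l) / Num.sqrt (N * H) * r `^ (- (b / (2 * b + 1)))
    <= 2 * C * Num.sqrt (4 / pj) * l `^ (a / 2).
Proof.
move=> N0 l0 rE pj0 b0 C0 HH.
have r0 : 0 < r by rewrite rE divr_gt0.
have b21 : 0 < 2 * b + 1 by lra.
set Z := r `^ (- _).
have Z0 : 0 < Z by rewrite powR_gt0.
have H0 : 0 < H by apply: lt_le_trans HH; rewrite !mulr_gt0 ?powR_gt0.
have S0 : 0 < Num.sqrt (N * H) by rewrite sqrtr_gt0 mulr_gt0.
have key : Num.sqrt l * Z <= Num.sqrt (N * H) * (Num.sqrt (4 / pj) * l `^ (a / 2)).
  have la : l `^ (a / 2) = Num.sqrt (l `^ a).
    exact/esym/sqrt_powR.
  have ZE : Z = Num.sqrt (Z * Z) by rewrite -expr2 sqrtr_sqr gtr0_norm.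
  have p4 : 0 < 4 / pj by rewrite divr_gt0.
  rewrite la {1}ZE -!sqrtrM ?(ltW l0) ?(ltW p4) ?mulr_ge0 ?(ltW N0) ?(ltW H0)//.
  rewrite ler_wsqrtr//.
  have -> : l * (Z * Z) = N * (pj * r `^ (2 * b + 1)^-1 / 4 * l `^ (- a)) *
      (4 / pj * l `^ a).
    have e1 : Z * Z = r `^ (2 * b + 1)^-1 / r.
      rewrite -[in X in _ / X](powRr1 (ltW r0)) -powRB ?(gt_eqF r0) ?implybT//.
      rewrite -powRD ?(gt_eqF r0) ?implybT//; congr powR; field.
      by rewrite gt_eqF.
    have e2 : l `^ (- a) = (l `^ a)^-1 by rewrite powRN.
    have la0 : 0 < l `^ a by rewrite powR_gt0.
    rewrite e1 e2 rE; move: (_ `^ (2 * b + 1)^-1) (l `^ a) la0 => x y y0.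
    by field; rewrite !gt_eqF.
  apply: ler_wpM2r; last by rewrite ler_pM2l.
  by rewrite mulr_ge0 ?powR_ge0// ltW.
rewrite mulrAC ler_pdivrMr//.
have -> : 2 * (C * Num.sqrt l) * Z = 2 * C * (Num.sqrt l * Z) by ring.
have -> : 2 * C * Num.sqrt (4 / pj) * l `^ (a / 2) * Num.sqrt (N * H) =
  2 * C * (Num.sqrt (N * H) * (Num.sqrt (4 / pj) * l `^ (a / 2))) by ring.
by rewrite ler_wpM2l// mulr_ge0.
Qed.

(** If [z < 1 / 2], the bound on [b / (2 * b + 1)] says [b <= z / (1 - 2 * z)], and
upper bounds on [b] pass to the supremum; if [1 / 2 <= z], every exponent
satisfies it. *)
Lemma rate_exponent_sup (R : realType) (S : set R) (z : R) :
  0 <= z -> (forall b, S b -> 0 < b /\ b / (2 * b + 1) <= z) ->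
  rate_exponent (ereal_sup (0%E |` [set b%:E | b in S])) <= z.
Proof.
move=> z0 HS; set v := ereal_sup _.
have v0 : (0 <= v)%E by apply: ereal_sup_ubound; left.
have rateE (u : R) : 0 <= u -> (u / (2 * u + 1) <= z) = (u * (1 - 2 * z) <= z).
  move=> u0; have u1 : 0 < 2 * u + 1 by lra.
  by rewrite ler_pdivrMr//; apply/idP/idP => h; lra.
have [z2|z2] := leP 2^-1 z.
  move: v0; case: v => [u||]//=; rewrite lee_fin => u0.
  by rewrite rateE//; have : u * (1 - 2 * z) <= 0; [rewrite mulr_ge0_le0//|]; lra.
have z12 : 0 < 1 - 2 * z by lra.
have : (v <= (z / (1 - 2 * z))%:E)%E.
  apply: ge_ereal_sup => _ [->|[b Sb <-]]; rewrite lee_fin.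
    by rewrite divr_ge0// ltW.
  have [b0 hb] := HS b Sb; rewrite ler_pdivlMr// -rateE//.
  exact: ltW.
move: v0; case: v => [u||]//=; rewrite !lee_fin => u0 uz.
by rewrite rateE// -ler_pdivlMr.
Qed.

(** Logarithms turn the claim into a bound on rate exponents. An element of [S]
below [bmin] has a smaller rate exponent than [bmin], which is in [S]. *)
Lemma power_rate_sup (R : realType) (S : set R) (r W Y bmin : R) :
  0 < r < 1 -> 0 <= W -> 0 < Y -> 0 < bmin -> S bmin ->
  (forall b, S b -> 0 < b) ->
  (forall b, S b -> bmin <= b -> W * r `^ (- (b / (2 * b + 1))) <= Y) ->
  W * r `^ (- rate_exponent (ereal_sup (0%E |` [set b%:E | b in S]))) <= Y.
Proof.
move=> /andP[r0 r1] W0 Y0 bmin0 Sbmin S0 HS.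
have [W0'|W0'] := eqVneq W 0; first by rewrite W0' mul0r ltW.
have Wp : 0 < W by rewrite lt_neqAle eq_sym W0'.
have lr : 0 < - ln r by rewrite oppr_gt0 ln_lt0// r0.
pose z := ln (Y / W) / (- ln r).
have zE x : (W * r `^ (- x) <= Y) = (x <= z).
  rewrite mulrC -ler_pdivlMr// -[LHS]ler_ln ?posrE ?powR_gt0 ?divr_gt0//.
  by rewrite ln_powR mulNr -mulrN -ler_pdivlMr.
have rate_mono (u v : R) : 0 < u -> u <= v -> u / (2 * u + 1) <= v / (2 * v + 1).
  move=> u0 uv; have u1 : 0 < 2 * u + 1 by lra.
  have v1 : 0 < 2 * v + 1 by lra.
  by rewrite ler_pdivrMr// mulrAC ler_pdivlMr//; lra.
have bz : bmin / (2 * bmin + 1) <= z by rewrite -zE HS.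
rewrite zE; apply: rate_exponent_sup => [|b Sb].
  by apply: le_trans bz; rewrite divr_ge0//; lra.
split; first exact: S0.
have [bb|bb] := leP bmin b; first by rewrite -zE HS.
by apply: le_trans bz; apply: rate_mono; [exact: S0|exact: ltW].
Qed.

(** As [1 / (2 * bmin + 1) < 1], a positive power of [N] is left to absorb the
powers of [ln N]. In logarithms this is a linear function of [l = ln N] against
multiples of [ln l], and [ln l <= 2 * sqrt l]. *)
Lemma exponents_asymptotics (R : realType) (bmin eps k2 : R) :
  0 < bmin -> 0 <= k2 ->
  exists M : R, forall n : nat, M <= ln (n./2)%:R :> R ->
    4 * 2 ^+ jmin eps * (ln (n./2)%:R / (n./2)%:R) `^ (- (2 * bmin + 1)^-1)
      <= (n./2)%:R / ln (n./2)%:R `^ k2.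
Proof.
move=> b0 k0; pose e := (2 * bmin + 1)^-1.
have b21 : 1 < 2 * bmin + 1 by lra.
have e0 : 0 < e by rewrite invr_gt0 (lt_trans _ b21).
have e1 : e < 1 by rewrite invf_lt1// (lt_trans _ b21).
pose a := 1 - e; have a0 : 0 < a by rewrite subr_gt0.
pose c := 4 * 2 ^+ jmin eps : R.
have c0 : 0 < c by rewrite mulr_gt0// exprn_gt0.
exists (Num.max 1 (Num.max ((4 * k2 / a) ^+ 2) (2 * ln c / a))) => n.
rewrite !ge_max -/c -/e; set l := ln _ => /and3P[l1 lk lc].
have l0 : 0 < l by exact: lt_le_trans l1.
have N0 : 0 < (n./2)%:R :> R by exact: ln_gt0_natr_gt0.
set r := l / _; have r0 : 0 < r by rewrite divr_gt0.
rewrite -ler_ln ?posrE ?mulr_gt0 ?invr_gt0 ?powR_gt0//.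
rewrite lnM ?posrE ?powR_gt0// ln_powR.
have -> : ln r = ln l - l by rewrite /r lnM ?posrE ?invr_gt0// lnV ?posrE.
have -> : ln ((n./2)%:R / l `^ k2) = l - k2 * ln l.
  by rewrite lnM ?posrE ?invr_gt0 ?powR_gt0// lnV ?posrE ?powR_gt0// ln_powR.
have s0 : 0 <= Num.sqrt l by exact: sqrtr_ge0.
have lnl0 : 0 <= ln l by exact: ln_ge0.
have lnl : ln l <= 2 * Num.sqrt l.
  rewrite -{1}(sqr_sqrtr (ltW l0)) lnXn ?sqrtr_gt0// -[ln _ *+ 2]mulr_natl ler_pM2l//.
  by apply: ln_le_id; rewrite sqrtr_gt0.
have sk : 4 * k2 / a <= Num.sqrt l.
  rewrite -[leLHS]ger0_norm ?divr_ge0 ?mulr_ge0 ?(ltW a0)//.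
  by rewrite -sqrtr_sqr ler_wsqrtr.
have lE : l = Num.sqrt l * Num.sqrt l by rewrite -expr2 sqr_sqrtr// ltW.
have h1 : k2 * ln l <= a / 2 * l.
  apply: (@le_trans _ _ (k2 * (2 * Num.sqrt l))); first by rewrite ler_wpM2l.
  rewrite [in leRHS]lE mulrA [leRHS]mulrA ler_wpM2r//.
  by move: sk; rewrite ler_pdivrMr//; clear; lra.
have h2 : ln c <= a / 2 * l.
  by move: lc; rewrite ler_pdivrMr//; clear; lra.
have h3 : 0 <= e * ln l by rewrite mulr_ge0// ltW.
have aE : a = 1 - e by [].
move: h1 h2 h3; rewrite aE; move: (ln c) (ln l) => x y.
by clear; move=> h1 h2 h3; lra.
Qed.

(** * Bound on the normalised width and conclusion *)

Lemma density_le (R : realType) (L eps b : R) (p : density R) :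
  0 < eps -> hoelder_class `]- eps, 1 + eps[%classic b L p ->
  forall x, - eps < x < 1 + eps -> p x <= L.
Proof.
move=> e0 [_ hp] x x01.
have U0 : (`]- eps, 1 + eps[%classic : set R) 0.
  by rewrite /= in_itv/=; apply/andP; split; lra.
have U1 : (`]- eps, 1 + eps[%classic : set R) 1.
  by rewrite /= in_itv/=; apply/andP; split; lra.
have u01 : 0 != 1 :> R by rewrite eq_sym oner_eq0.
have [H _] := hoelder_norm_bounds U0 U1 u01 hp.
apply: (le_trans (ler_norm _)); apply: H.
by rewrite /= in_itv.
Qed.

Lemma local_radius_le (R : realType) (eps b : R) (n : nat) :
  0 < b -> 0 < (ln (n./2)%:R / (n./2)%:R : R) <= 1 ->
  0 < local_radius eps n b <= 2 ^- jmin eps.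
Proof.
move=> b0 /andP[r0 r1]; rewrite /local_radius.
have pj0 : 0 < 2 ^- jmin eps :> R by rewrite invr_gt0 exprn_gt0.
rewrite mulr_gt0 ?powR_gt0//= ler_piMr ?(ltW pj0)//.
by rewrite -[leRHS](powRr0 (ln (n./2)%:R / (n./2)%:R)) ger_powR ?r0//
  invr_ge0 addr_ge0// mulr_ge0// ltW.
Qed.

(** A density of the class is smooth of order [bmin] on a whole neighbourhood of the
unit interval, so [bmin] is among the exponents that define the local one, and
bounds for the exponents from [bmin] on suffice. *)
Lemma normalised_width_le (R : realType) (K : R -> R) (l : nat)
    (c L eps bmin k1 k2 c1 c2 alpha C : R) (n : nat) (p : density R)
    (x1 x2 : (n./2).-tuple R) (ln_N := ln (n./2)%:R : R) :
  is_kernel K -> kernel_order K l -> 0 < c -> (forall v, `|K v| <= c) ->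
  kernel_deviation_bound K c p x2 -> interval_deviation_bound L eps p x2 ->
  hoelder_class `]- eps, 1 + eps[%classic bmin L p ->
  0 < L -> 0 < eps < 1 -> 0 < bmin < 1 -> (2 * bmin)^-1 <= k1 -> 4 <= k2 ->
  4 * c * (11 * L + 5) + 4 * c * L <= c2 ->
  2 <= ln_N -> ln_N / (n./2)%:R < 1 ->
  4 * 2 ^+ jmin eps * (ln_N / (n./2)%:R) `^ (- (2 * bmin + 1)^-1)
    <= (n./2)%:R / ln_N `^ k2 ->
  0 < C -> critical_value K bmin L eps k1 n alpha <= C * Num.sqrt ln_N ->
  (normalised_width K l bmin L eps k1 k2 c1 c2 alpha p x1 x2
   <= (2 * C * Num.sqrt (4 / 2 ^- jmin eps) * ln_N `^ (c1 * ln 2 / 2))%:E)%E.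
Proof.
move=> kK oK c0 Kc Kdisc dev hp L0 eps01 b01 hk1 k4 hc2 l2 r1 r_large C0 qC.
have [e0 e1] := andP eps01; have [bmin0 bmin1] := andP b01.
have l0 : 0 < ln_N by apply: lt_le_trans l2.
have N0 : 0 < (n./2)%:R :> R by exact: ln_gt0_natr_gt0.
have r0 : 0 < ln_N / (n./2)%:R by rewrite divr_gt0.
have [_ jmeps] := jmin_ge e0.
have pj0 : 0 < 2 ^- jmin eps :> R by rewrite invr_gt0 exprn_gt0.
apply: ge_ereal_sup => _ [t t01 <-].
have {}t01 : 0 <= t <= 1 by move: t01; rewrite /= in_itv.
set H := hloc K bmin eps k1 k2 c1 c2 x2 t.
set W := 2 * (C * Num.sqrt ln_N) / Num.sqrt ((n./2)%:R * H).
have W0 : 0 <= W.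
  by rewrite /W !mulr_ge0 ?invr_ge0 ?sqrtr_ge0 ?(ltW C0).
pose S := [set b : R | 0 < b /\
    hoelder_capped l.+1%:R (oball t (local_radius eps n b)) b L p].
have Sbmin : S bmin.
  split=> //; apply: hoelder_class_capped hp.
    by rewrite (le_trans (ltW bmin1))// ler1n.
  have r01 : 0 < ln_N / (n./2)%:R <= 1 by rewrite r0 ltW.
  have /andP[_ hr] := local_radius_le eps bmin0 r01.
  move=> y; rewrite /oball/= !in_itv/=.
  move: hr jmeps t01 e0; move: (2 ^- jmin eps) (local_radius _ _ _) => pj h.
  clear => hr jmeps /andP[t0 t1] e0 /andP[y0 y1].
  by apply/andP; split; lra.
have Y0 : 0 < 2 * C * Num.sqrt (4 / 2 ^- jmin eps) * ln_N `^ (c1 * ln 2 / 2).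
  by rewrite !mulr_gt0 ?powR_gt0// sqrtr_gt0 divr_gt0.
apply: (@le_trans _ _ (W * (ln_N / (n./2)%:R)
    `^ (- rate_exponent (ereal_sup (0%E |` [set b%:E | b in S]))))%:E).
  rewrite EFinM; apply: lee_wpmul2r; first by rewrite lee_fin powR_ge0.
  apply: band_width_le => //.
  by rewrite mulr_ge0 ?(ltW C0) ?sqrtr_ge0.
rewrite lee_fin; apply: (power_rate_sup (bmin := bmin)) => //.
- by rewrite r0.
- by move=> b [].
- move=> b [b0 hb] bb.
  apply: (width_rate_le (pj := 2 ^- jmin eps)) => //; first exact: ltW.
  exact: (bandwidth_lower_bound c1 kK oK c0 Kc Kdisc dev L0 eps01 b01 hk1 k4 hc2
    l2 r1 r_large t01 bb hb).
Qed.

Lemma ln_half_unbounded (R : realType) (M : R) :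
  \forall n \near \oo, M <= ln (n./2)%:R.
Proof.
exists (2 * (Num.truncn (expR M)).+1)%N => // n /= hn.
rewrite -[leLHS]expRK ler_ln ?posrE ?expR_gt0//; last first.
  by rewrite ltr0n half_gt0; apply: leq_trans hn; rewrite mulnS.
apply: (le_trans (ltW (truncnS_gt _))); rewrite ler_nat.
by rewrite -[leqLHS](doubleK _) -muln2 mulnC half_leq.
Qed.

Lemma cvg_harmonic_bound (R : realType) :
  (fun n => (128 * harmonic n)%:E : \bar R) @ \oo --> (0 : R)%:E.
Proof.
apply: cvg_EFin; first by near=> n.
rewrite -[X in _ --> X](mulr0 (128 : R)).
by apply: cvgM; [exact: cvg_cst|exact: cvg_harmonic].
Unshelve. all: by end_near. Qed.

Lemma inverse_square_half_le (R : realType) (n : nat) : (0 < n./2)%N ->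
  32 / (n./2)%:R ^+ 2 <= 128 * harmonic n :> R.
Proof.
move=> N0; have N0' : 0 < (n./2)%:R :> R by rewrite ltr0n.
have N1 : 1 <= (n./2)%:R :> R by rewrite ler1n.
have n4 : n.+1%:R <= 4 * (n./2)%:R :> R.
  by rewrite -natrM ler_nat; have := odd_double_half n; lia.
rewrite /harmonic/= ler_pdivrMr ?exprn_gt0// mulrAC ler_pdivlMr ?ltr0Sn//.
apply: (@le_trans _ _ (32 * (4 * (n./2)%:R))); first by rewrite ler_pM2l.
by rewrite mulrA -natrM ler_pM2l// expr2 ler_peMl// ltW.
Qed.

Theorem theorem3p12 (R : realType) :
  exists gamma : R -> R,
  forall (K : R -> R) (l : nat) (A nu bmin L eps : R),
    is_kernel K -> kernel_order K l ->
    0 < A -> 0 < nu -> kernel_entropy K A nu ->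
    0 < bmin < 1 -> 0 < L -> 0 < eps < 1 ->
  exists c2bar : R,
  forall (c2 M alpha k1 c1 k2 : R),
    c2bar <= c2 -> 0 < M -> 0 < alpha < 1 ->
    (2 * bmin)^-1 <= k1 -> 2 / (bmin * ln 2) < c1 -> c1 * ln 2 + 4 < k2 ->
    (\forall n \near \oo, densities K l bmin L eps M n !=set0) ->
  forall x1 : forall n : nat, (n./2).-tuple R,
    limn_esup (fun n : nat =>
      ereal_sup [set
        iid_law (law p) n./2
          [set x2 : (n./2).-tuple (measurableTypeR R) |
            ((ln (n./2)%:R `^ gamma c1)%:E <=
             normalised_width K l bmin L eps k1 k2 c1 c2 alpha p (x1 n) x2)%E]
        | p in densities K l bmin L eps M n]) = 0%E.
Proof.
(* The width is of order [(ln N) `^ (c1 * ln 2 / 2)]; one more power of [ln N]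
   absorbs the constants. *)
exists (fun c1 => c1 * ln 2 / 2 + 1).
move=> K l A nu bmin L eps kK oK _ _ _ b01 L0 eps01.
have [e0 e1] := andP eps01; have [bmin0 bmin1] := andP b01.
have [c [c0 Kc Kdisc]] := kernel_interval_discrepancy kK.
(* A difference of two estimates involves two stochastic errors, with constant
   [2 * c * (11 * L + 5)] each, and two biases, with constant [2 * c * L] each. *)
exists (4 * c * (11 * L + 5) + 4 * c * L).
move=> c2 M alpha k1 c1 k2 hc2 _ _ hk1 hc1 hk2 nonempty x1.
have ln2 := ln2_gt0 R.
have c10 : 0 < c1.
  by apply: lt_trans hc1; rewrite divr_gt0// mulr_gt0.
have k4 : 4 <= k2.
  have : 0 < c1 * ln 2 by rewrite mulr_gt0.
  by move: hk2; move: (c1 * ln 2) => y; clear; lra.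
have k20 : 0 <= k2 by apply: le_trans k4.
have [C [C0 HC]] := critical_value_le K L alpha b01 e0 hk1.
have [M1 HM1] := exponents_asymptotics eps bmin0 k20.
pose Y := 2 * C * Num.sqrt (4 / 2 ^- jmin eps).
pose M0 := Num.max (Num.max 2 (4 / eps)) (Num.max M1 (Y + 1)).
set u := (X in limn_esup X).
suff u0 : u @ \oo --> 0%E.
  by rewrite is_cvg_limn_esupE; [exact: cvg_lim|apply/cvg_ex; exists 0%E].
apply: (@squeeze_cvge _ _ _ _ (cst 0%E) _ (fun n => (128 * harmonic n)%:E));
  [|exact: cvg_cst|exact: cvg_harmonic_bound].
near=> n; apply/andP; split.
  have [p hp] : densities K l bmin L eps M n !=set0 by near: n.
  apply: le_trans (ereal_sup_ubound (ex_intro2 _ _ p hp erefl)).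
  exact: measure_ge0.
have : M0 <= ln (n./2)%:R by near: n; exact: ln_half_unbounded.
rewrite /M0 !ge_max => /andP[/andP[l2 leps] /andP[lM1 lY]].
set ln_N := ln _ in l2 leps lM1 lY.
have l0 : 0 < ln_N by apply: lt_le_trans l2.
have N0 : 0 < (n./2)%:R :> R by exact: ln_gt0_natr_gt0.
have lnN : ln_N < (n./2)%:R.
  have : ln (1 + ((n./2)%:R - 1)) <= (n./2)%:R - 1 :> R.
    by apply: le_ln1Dx; rewrite ltrBrDr addNr.
  rewrite addrC subrK -/ln_N => /le_lt_trans; apply.
  by rewrite gtrBl.
have r1 : ln_N / (n./2)%:R < 1 by rewrite ltr_pdivrMr// mul1r.
have epsN : 4 < eps * (n./2)%:R.
  by rewrite mulrC -ltr_pdivrMr//; exact: le_lt_trans lnN.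
rewrite /u; apply: ge_ereal_sup => _ [p [[hp _] _] <-].
have N0' : (0 < n./2)%N by rewrite -(ltr_nat R).
have l1 : 1 <= ln_N by apply: le_trans l2; rewrite ler1n.
have [B [mB PB HB]] := interval_deviation L0 eps01 N0' l1 epsN (density_le e0 hp).
apply: (@le_trans _ _ (iid_law (law p) n./2 B)); last first.
  by apply: (le_trans PB); rewrite lee_fin; exact: inverse_square_half_le.
apply: le_iid_law => x2 /= hx2; apply: contrapT => nB.
have := normalised_width_le c1 (x1 n) kK oK c0 Kc (Kdisc p _ x2) (HB x2 nB)
  hp L0 eps01 b01 hk1 k4 hc2 l2 r1 (HM1 n lM1) C0 (HC n l2 (ltW r1)).
move=> /(le_trans hx2); rewrite -/ln_N lee_fin leNgt => /negP; apply.
rewrite addrC powRD; last by rewrite (gt_eqF l0) implybT.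
rewrite powRr1 ?(ltW l0)// ltr_pM2r ?powR_gt0//.
by apply: lt_le_trans lY; rewrite ltrDl.
Unshelve. all: by end_near. Qed.
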